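(* Let $\mathbb R^{m+k}=\mathbb R^m\times\mathbb R^k$ ($k\ge1$) carry the canonical Euclidean metric $g_{can}$ and the foliation with leaves $\{x\}\times\mathbb R^k$, and let $f:(\mathbb R^{m+k},\mathbb R^k,g_{can})\to(N,\widetilde{\mathcal F},\widetilde g)$ be a horizontally harmonic map into a Riemannian foliation. Assume that $m>2$. Then $$\frac{\int_{D_{\rho_1,\delta}(x_0,y_0)}|df_{\mathcal H,\widetilde{\mathcal H}}|^2\,dV_g}{\rho_1^{m-2}}\le\frac{\int_{D_{\rho_2,\delta}(x_0,y_0)}|df_{\mathcal H,\widetilde{\mathcal H}}|^2\,dV_g}{\rho_2^{m-2}}$$ for any $(x_0,y_0)\in\mathbb R^{m+k}$, $\delta>0$ and $0<\rho_1\le\rho_2$, where $g=g_{can}$ and $D_{\rho,\delta}(x_0,y_0)=\{(x,y)\in\mathbb R^m\times\mathbb R^k:|x-x_0|\le\rho,\ |y-y_0|\le\delta\}$.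
   Context: A foliation on a smooth manifold $M$ is given by an integrable distribution $\mathcal V\subset TM$. Given a Riemannian metric $g$, put $\mathcal H=\mathcal V^\perp$ with orthogonal projections $\pi_{\mathcal H},\pi_{\mathcal V}$ and $g_{\mathcal H}=g(\pi_{\mathcal H}\cdot,\pi_{\mathcal H}\cdot)$. $(M,\mathcal F,g)$ is a Riemannian foliation if $\mathcal L_Ug_{\mathcal H}=0$ for every section $U$ of $\mathcal V$. Let $\nabla$ be the Levi-Civita connection of $g$. For $X,Y$ horizontal, $U$ vertical: $\mathcal W_XU=-\pi_{\mathcal V}(\nabla_UX)$, $\mathcal T_XY=\pi_{\mathcal V}(\nabla_XY)=\frac12\pi_{\mathcal V}([X,Y])$, extended to $TM$ by first projecting the arguments; $\mathcal T^*$ is defined by $g(\mathcal T_X^*Y,Z)=g(Y,\mathcal T_XZ)$. Objects on $N$ carry a tilde. For a smooth map $f:M\to N$: $df_{\mathcal H,\widetilde{\mathcal H}}=\pi_{\widetilde{\mathcal H}}\circ df\circ\pi_{\mathcal H}$, $df_{\mathcal H,\widetilde{\mathcal V}}=\pi_{\widetilde{\mathcal V}}\circ df\circ\pi_{\mathcal H}$; $|df_{\mathcal H,\widetilde{\mathcal H}}|^2=\sum_i|df_{\mathcal H,\widetilde{\mathcal H}}(e_i)|^2$ for a local orthonormal frame $\{e_i\}$ of $\mathcal H$. With $\widetilde\nabla$ also the pull-back connection on $f^{-1}TN$, $\beta_{\mathcal H,\widetilde{\mathcal H}}(X,Y)=\widetilde\nabla_X(df_{\mathcal H,\widetilde{\mathcal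 H}}(Y))-df_{\mathcal H,\widetilde{\mathcal H}}(\nabla_XY)$. The map $f$ is horizontally harmonic if it is a critical point of $E_{\mathcal H,\widetilde{\mathcal H}}(f)=\frac12\int_M|df_{\mathcal H,\widetilde{\mathcal H}}|^2dV_g$, that is, $\operatorname{tr}_g\beta_{\mathcal H,\widetilde{\mathcal H}}+\sum_i\big(\widetilde{\mathcal T}^*_{df_{\mathcal H,\widetilde{\mathcal H}}(e_i)}df_{\mathcal H,\widetilde{\mathcal V}}(e_i)+\widetilde{\mathcal W}_{df_{\mathcal H,\widetilde{\mathcal H}}(e_i)}df_{\mathcal H,\widetilde{\mathcal V}}(e_i)\big)=0$. *)

(* Defs.v *)
From HB Require Import structures.
From mathcomp Require Import all_boot all_order all_algebra.
From mathcomp Require Import all_classical all_reals all_analysis.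
From mathcomp Require Import ring.

Set Implicit Arguments.
Unset Strict Implicit.
Unset Printing Implicit Defensive.

Import Order.TTheory GRing.Theory Num.Theory.
Import numFieldNormedType.Exports.

Local Open Scope classical_set_scope.
Local Open Scope ring_scope.

(* The sigma-algebra on 'rV_n generated by the coordinates, i.e. the Borel    *)
(* sigma-algebra of R^n.                                                      *)
Definition row_display : measure_display. Proof. exact: default_measure_display. Qed.

Section measurable_row.
Variables (R : realType) (n : nat).

Let coord (i : 'I_n) (x : 'rV[R]_n) : measurableTypeR R := x ord0 i.

Let row_set0 : g_sigma_preimage coord set0.
Proof. exact: sigma_algebra0. Qed.

Let row_setC A : g_sigma_preimage coord A -> g_sigma_preimage coord (~` A).
Proof. exact: sigma_algebraC. Qed.

Let row_bigcup (E : (set 'rV[R]_n)^nat) :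
  (forall i, g_sigma_preimage coord (E i)) ->
  g_sigma_preimage coord (\bigcup_i (E i)).
Proof. exact: sigma_algebra_bigcup. Qed.

HB.instance Definition _ := @isMeasurable.Build row_display 'rV[R]_n
  (g_sigma_preimage coord) row_set0 row_setC row_bigcup.

Lemma measurable_coord (i : 'I_n) :
  measurable_fun [set: 'rV[R]_n] (fun x : 'rV[R]_n => x ord0 i : measurableTypeR R).
Proof.
move=> _ Y mY; rewrite setTI; apply: sub_sigma_algebra => /=.
rewrite -bigcup_seq/=; exists i => /=; first by rewrite mem_index_enum.
by exists Y => //; rewrite setTI.
Qed.

Lemma measurable_fun_rowP d (T : measurableType d) (f : T -> 'rV[R]_n) :
  (forall i, measurable_fun setT (fun t => f t ord0 i : measurableTypeR R)) ->
  measurable_fun setT f.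
Proof.
move=> mf _ A mA; rewrite setTI.
have : preimage_set_system setT f (g_sigma_preimage coord) (f @^-1` A).
  by exists A => //; rewrite setTI.
rewrite -(g_sigma_preimage_comp coord f); apply: smallest_sub.
  exact: sigma_algebra_measurable.
rewrite -bigcup_seq => B [i _ [C mC <-]].
by have := mf i measurableT C mC.
Qed.

End measurable_row.

Section lebesgue_row.
Variable R : realType.

Definition consr n (p : measurableTypeR R * 'rV[R]_n) : 'rV[R]_n.+1 :=
  row_mx (p.1%:M : 'rV[R]_1) p.2.

Lemma consr0 n p : @consr n p ord0 ord0 = p.1.
Proof.
have -> : (ord0 : 'I_n.+1) = lshift n (ord0 : 'I_1) by exact: val_inj.
by apply: etrans (row_mxEl _ _ _ _) _; rewrite mxE.
Qed.

Lemma consrS n p (i : 'I_n) : consr p ord0 (lift ord0 i) = p.2 ord0 i.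
Proof.
have -> : lift ord0 i = rshift 1 i by exact: val_inj.
exact: row_mxEr.
Qed.

Lemma measurable_consr n : measurable_fun setT (@consr n).
Proof.
apply: measurable_fun_rowP => i; case: (unliftP ord0 i) => [j|] ->.
  rewrite (_ : (fun t => _) = (fun x : 'rV[R]_n => x ord0 j : measurableTypeR R) \o snd).
    exact: measurableT_comp (measurable_coord j) _.
  by apply/funext => t; exact: consrS.
rewrite (_ : (fun t => _) = fst) //.
by apply/funext => t; exact: consr0.
Qed.

Definition unconsr n (x : 'rV[R]_n.+1) : measurableTypeR R * 'rV[R]_n :=
  (x ord0 ord0, \row_i x ord0 (lift ord0 i)).

Lemma measurable_unconsr n : measurable_fun setT (@unconsr n).
Proof.
apply/measurable_fun_pairP; split; first exact: measurable_coord.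
apply: measurable_fun_rowP => i.
rewrite (_ : (fun t => _) = fun x : 'rV[R]_n.+1 => x ord0 (lift ord0 i)).
  exact: measurable_coord.
by apply/funext => t; rewrite /= mxE.
Qed.

Lemma consrK n : cancel (@consr n) (@unconsr n).
Proof.
move=> p; rewrite /unconsr consr0 [RHS]surjective_pairing; congr pair.
by apply/rowP => i; rewrite mxE consrS.
Qed.

Lemma unconsrK n : cancel (@unconsr n) (@consr n).
Proof.
move=> x; apply/rowP => i; case: (unliftP ord0 i) => [j|] ->.
  by rewrite consrS /= mxE.
by rewrite consr0.
Qed.

Section step.
Variables (n : nat) (mu : {sigma_finite_measure set 'rV[R]_n -> \bar R}).

Definition lebesgue_step : set 'rV[R]_n.+1 -> \bar R :=
  pushforward (lebesgue_measure \x mu)%E (@consr n).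

Let step0 : lebesgue_step set0 = 0%E.
Proof. by rewrite /lebesgue_step /pushforward preimage_set0 measure0. Qed.

Let step_ge0 A : (0 <= lebesgue_step A)%E.
Proof. by rewrite /lebesgue_step /pushforward; exact: measure_ge0. Qed.

Let step_sigma_additive : semi_sigma_additive lebesgue_step.
Proof.
move=> E mE tE mUE; rewrite /lebesgue_step /pushforward preimage_bigcup.
apply: measure_semi_sigma_additive.
- by move=> i; rewrite -[X in measurable X]setTI; exact: measurable_consr.
- apply/trivIsetP => i j _ _ ij; rewrite -preimage_setI.
  by move/trivIsetP : tE => /(_ _ _ I I ij) ->; rewrite preimage_set0.
- by rewrite -preimage_bigcup -[X in measurable X]setTI; exact: measurable_consr.
Qed.

HB.instance Definition _ := isMeasure.Build _ _ _ lebesgue_step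
  step0 step_ge0 step_sigma_additive.

Let step_sigma_finite : sigma_finite setT lebesgue_step.
Proof.
have /sigma_finiteP[E [ET ndE Eoo]] := sigma_finiteT (@lebesgue_measure R).
have /sigma_finiteP[G [GT ndG Goo]] := sigma_finiteT mu.
exists (fun i => @unconsr n @^-1` (E i `*` G i)).
  rewrite -preimage_bigcup (_ : \bigcup_i _ = setT) ?preimage_setT//.
  apply/seteqP; split => // -[t x] _.
  have [a _ Ea] : (\bigcup_i E i) t by rewrite -ET.
  have [b _ Gb] : (\bigcup_i G i) x by rewrite -GT.
  exists (maxn a b) => //; split.
    by move: t Ea; exact/subsetPset/ndE/leq_maxl.
  by move: x Gb; exact/subsetPset/ndG/leq_maxr.
move=> i; have [mE Elt] := Eoo i; have [mG Glt] := Goo i; split.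
  rewrite -[X in measurable X]setTI; apply: measurable_unconsr => //.
  exact: measurableX.
rewrite /lebesgue_step /pushforward -comp_preimage (_ : _ \o _ = id); last first.
  by apply/funext => p; exact: consrK.
by rewrite /= product_measure1E// lte_mul_pinfty// ge0_fin_numE.
Qed.

HB.instance Definition _ := Measure_isSigmaFinite.Build _ _ _ lebesgue_step
  step_sigma_finite.

End step.

(* Lebesgue measure on R^n: the unit mass on R^0, and on R^(n+1) the product  *)
(* of the Lebesgue measures on R and R^n.                                     *)
Fixpoint lebesgue_row n : {sigma_finite_measure set 'rV[R]_n -> \bar R} :=
  match n with
  | 0%N => \d_(0 : 'rV[R]_0)
  | n'.+1 => lebesgue_step (lebesgue_row n')
  end.

Definition box n (a b : 'rV[R]_n) : set 'rV[R]_n :=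
  [set x | forall i, a ord0 i < x ord0 i <= b ord0 i].

Lemma measurable_box n (a b : 'rV[R]_n) : measurable (box a b).
Proof.
rewrite (_ : box a b = \bigcap_(i in [set: 'I_n])
    (fun x : 'rV[R]_n => x ord0 i) @^-1` `]a ord0 i, b ord0 i]); last first.
  by apply/seteqP; split => x /= xab i; have := xab i; rewrite /= in_itv //=; exact.
apply: fin_bigcap_measurable => // i _.
rewrite -[X in measurable X]setTI.
by apply: measurable_coord => //; exact: measurable_itv.
Qed.

Lemma lebesgue_row_box n (a b : 'rV[R]_n) :
  (forall i, a ord0 i <= b ord0 i) ->
  lebesgue_row n (box a b) = (\prod_(i < n) (b ord0 i - a ord0 i))%:E.
Proof.
elim: n a b => [|n ih] a b ab /=.
  by rewrite big_ord0 diracE mem_set// => -[].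
pose a' : 'rV[R]_n := \row_i a ord0 (lift ord0 i).
pose b' : 'rV[R]_n := \row_i b ord0 (lift ord0 i).
pose I0 : set (measurableTypeR R) := `]a ord0 ord0, b ord0 ord0]%classic.
have -> : lebesgue_step (lebesgue_row n) (box a b) =
    (lebesgue_measure \x lebesgue_row n)%E (I0 `*` box a' b').
  rewrite /lebesgue_step /pushforward; congr product_measure1.
  apply/seteqP; split => [p abp|p [ab0 abS] i].
    split; first by have := abp ord0; rewrite consr0 /I0 /= in_itv.
    by move=> i; have := abp (lift ord0 i); rewrite consrS !mxE.
  case: (unliftP ord0 i) => [j|] ->.
    by have := abS j; rewrite consrS !mxE.
  by rewrite consr0; move: ab0; rewrite /I0 /= in_itv.
rewrite product_measure1E; [|exact: measurable_itv|exact: measurable_box].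
rewrite ih; last by move=> i; rewrite !mxE.
rewrite big_ord_recl EFinM; congr (_ * _)%E; last first.
  by congr EFin; apply: eq_bigr => i _; rewrite !mxE.
apply: etrans (lebesgue_measure_itv _) _; rewrite /= lte_fin.
have := ab ord0; rewrite le_eqVlt => /orP[/eqP->|->]//.
by rewrite ltxx subrr.
Qed.

End lebesgue_row.

Fixpoint Ck_on (R : realType) (U V : normedModType R) (j : nat) (A : set U)
    (f : U -> V) : Prop :=
  (forall x, A x -> {for x, continuous f}) /\
  if j is j'.+1 then
    forall v, (forall x, A x -> derivable f x v) /\ Ck_on j' A ('D_v f)
  else True.

(* Meant for A open and U of finite dimension.                                *)
Definition smooth_on (R : realType) (U V : normedModType R) (A : set U)
    (f : U -> V) : Prop := forall j, Ck_on j A f.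

Section manifolds.
Variables (R : realType) (n : nat).

(* cmap and cinv are junk outside of cdom, resp. of its image.                *)
Record chart (N : topologicalType) := Chart {
  cdom : set N;
  cmap : N -> 'rV[R]_n;
  cinv : 'rV[R]_n -> N;
  cdom_open : open cdom;
  cimg_open : open (cmap @` cdom);
  cmapK : forall q, cdom q -> cinv (cmap q) = q;
  cmap_continuous : forall q, cdom q -> {for q, continuous cmap};
  cinv_continuous : forall z, (cmap @` cdom) z -> {for z, continuous cinv} }.

Definition transition (N : topologicalType) (c c' : chart N) :
  'rV[R]_n -> 'rV[R]_n := cmap c' \o cinv c.

Definition smooth_transition (N : topologicalType) (c c' : chart N) : Prop :=
  smooth_on (cmap c @` (cdom c `&` cdom c')) (transition c c').

Record manifold := Manifold {
  mpoint :> topologicalType;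
  manifold_hausdorff : hausdorff_space mpoint;
  manifold_second_countable : @second_countable mpoint;
  atlas : set (chart mpoint);
  chart_at : mpoint -> chart mpoint;
  atlas_chart_at : forall q, atlas (chart_at q);
  chart_at_dom : forall q, cdom (chart_at q) q;
  atlas_smooth : forall c c', atlas c -> atlas c' -> smooth_transition c c';
  atlas_maximal : forall c,
    (forall c', atlas c' -> smooth_transition c c' /\ smooth_transition c' c) ->
    atlas c }.

(* A tangent vector at q is given in each chart c by its row of components    *)
(* v : 'rV_n, and its components in c' are v *m chart_jac c c' q.             *)
Definition chart_jac (N : manifold) (c c' : chart N) (q : N) : 'M[R]_n :=
  'J (transition c c') (cmap c q).

(* met c q is the Gram matrix at q of the coordinate frame of c.              *)
Record metric (N : manifold) := Metric {
  met : chart N -> N -> 'M[R]_n;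
  met_sym : forall c q, atlas c -> cdom c q -> (met c q)^T = met c q;
  met_pos : forall c q (v : 'rV[R]_n), atlas c -> cdom c q -> v != 0 ->
    0 < (v *m met c q *m v^T) ord0 ord0;
  met_smooth : forall c, atlas c ->
    smooth_on (cmap c @` cdom c) (met c \o cinv c);
  met_change : forall c c' q, atlas c -> atlas c' -> cdom c q -> cdom c' q ->
    met c q = chart_jac c c' q *m met c' q *m (chart_jac c c' q)^T }.

(* The distribution V is given in the chart c at q by the row space of        *)
(* vert c q.  Integrability: around every point there is a chart in which the *)
(* leaves are the slices where the first codim coordinates are constant       *)
(* (copid_mx r has the coordinate vectors of index at least r as row space).  *)
Record foliation (N : manifold) := Foliation {
  codim : nat;
  codim_le : (codim <= n)%N;
  vert : chart N -> N -> 'M[R]_n;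
  vert_change : forall c c' q, atlas c -> atlas c' -> cdom c q -> cdom c' q ->
    (vert c' q :=: vert c q *m chart_jac c c' q)%MS;
  vert_integrable : forall q, exists c, [/\ atlas c, cdom c q &
    forall q', cdom c q' -> (vert c q' :=: copid_mx codim)%MS] }.

Section riemannian_geometry.
Variables (N : manifold) (F : foliation N) (g : metric N) (c : chart N).

Definition inner (q : N) (u v : 'rV[R]_n) : R :=
  (u *m met g c q *m v^T) ord0 ord0.

(* The row space of kermx (met g c q *m (vert F c q)^T) is the orthogonal     *)
(* complement of V.                                                           *)
Definition horz (q : N) : 'M[R]_n := kermx (met g c q *m (vert F c q)^T).
Definition piV (q : N) : 'M[R]_n := proj_mx (vert F c q) (horz q).
Definition piH (q : N) : 'M[R]_n := proj_mx (horz q) (vert F c q).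

Definition dmet (q : N) (i a b : 'I_n) : R :=
  'D_(delta_mx ord0 i) (fun z => met g c (cinv c z) a b) (cmap c q).

(* The symbol with upper index l and lower indices i, j.                      *)
Definition christoffel (q : N) (l i j : 'I_n) : R :=
  2^-1 * \sum_b invmx (met g c q) l b
                * (dmet q i b j + dmet q j b i - dmet q b i j).

Definition gamma (q : N) (u w : 'rV[R]_n) : 'rV[R]_n :=
  \row_l \sum_i \sum_j christoffel q l i j * u ord0 i * w ord0 j.

(* The Levi-Civita derivative at q, in the direction v, of the vector field   *)
(* with components Z in the chart c.                                          *)
Definition nabla (Z : N -> 'rV[R]_n) (q : N) (v : 'rV[R]_n) : 'rV[R]_n :=
  'D_v (Z \o cinv c) (cmap c q) + gamma q v (Z q).

(* W and T are tensorial, so they can be computed at q on the vector fields   *)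
(* with constant components in c.                                             *)
Definition tensW (q : N) (X U : 'rV[R]_n) : 'rV[R]_n :=
  - (nabla (fun q' => X *m piH q') q (U *m piV q) *m piV q).

Definition tensT (q : N) (X Y : 'rV[R]_n) : 'rV[R]_n :=
  nabla (fun q' => Y *m piH q') q (X *m piH q) *m piV q.

Definition tensTstar (q : N) (X Y : 'rV[R]_n) : 'rV[R]_n :=
  xget 0 [set w | forall Z, inner q w Z = inner q Y (tensT q X Z)].

(* The Gram matrix of g_H, as a function of the coordinates.                  *)
Definition gramH (z : 'rV[R]_n) : 'M[R]_n :=
  piH (cinv c z) *m met g c (cinv c z) *m (piH (cinv c z))^T.

(* (L_U h)(X, Y) = U(h(X, Y)) - h([U, X], Y) - h(X, [U, Y]), where            *)
(* [U, X] = - D_X U when X has constant components.                           *)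
Definition lie_derivative (U : 'rV[R]_n -> 'rV[R]_n) (h : 'rV[R]_n -> 'M[R]_n)
    (z : 'rV[R]_n) : 'M[R]_n :=
  'D_(U z) h z + 'J U z *m h z + h z *m ('J U z)^T.

End riemannian_geometry.

Definition riemannian_foliation (N : manifold) (F : foliation N)
    (g : metric N) : Prop :=
  forall (c : chart N) (U : 'rV[R]_n -> 'rV[R]_n), atlas c ->
    smooth_on (cmap c @` cdom c) U ->
    (forall z, (cmap c @` cdom c) z -> (U z <= vert F c (cinv c z))%MS) ->
    forall z, (cmap c @` cdom c) z -> lie_derivative U (gramH F g c) z = 0.

(* The symbols define the torsion-free connection compatible with the metric. *)
Section levi_civita.
Variables (N : manifold) (g : metric N) (c : chart N) (q : N).
Hypotheses (ac : atlas c) (cq : cdom c q).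

Let dmet_sym i a b : dmet g c q i a b = dmet g c q i b a.
Proof.
apply: near_eq_derive => //.
have : nbhs (cmap c q) (cmap c @` cdom c).
  by apply: open_nbhs_nbhs; split; [exact: cimg_open|exists q].
apply: filterS => _ [q' cq' <-]; rewrite cmapK//.
by rewrite -[in LHS](met_sym g ac cq') mxE.
Qed.

Let met_unit : met g c q \in unitmx.
Proof.
rewrite -row_free_unit -kermx_eq0; apply/eqP/row_matrixP => i; rewrite row0.
apply/eqP/negPn/negP => /(met_pos g ac cq).
by rewrite -row_mul mulmx_ker row0 mul0mx mxE ltxx.
Qed.

Lemma christoffel_torsion_free l i j :
  christoffel g c q l i j = christoffel g c q l j i.
Proof.
congr (_ * _); apply: eq_bigr => b _; congr (_ * _).
by rewrite (dmet_sym b i j) [dmet _ _ _ i _ _ + _]addrC.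
Qed.

Let christoffel_lower i a b : \sum_l christoffel g c q l i a * met g c q l b =
  2^-1 * (dmet g c q i b a + dmet g c q a b i - dmet g c q b i a).
Proof.
pose w : 'rV[R]_n := \row_d (dmet g c q i d a + dmet g c q a d i - dmet g c q d i a).
have met_symE x y : met g c q x y = met g c q y x.
  by rewrite -[in LHS](met_sym g ac cq) mxE.
have iT : (invmx (met g c q))^T = invmx (met g c q).
  by rewrite trmx_inv met_sym.
transitivity (\sum_l 2^-1 * (w *m invmx (met g c q)) ord0 l * met g c q l b).
  apply: eq_bigr => l _; congr (_ * _ * _); rewrite mxE; apply: eq_bigr => d _.
  by rewrite mulrC [w _ _]mxE -[in LHS]iT mxE.
under eq_bigr do rewrite -mulrA.
rewrite -mulr_sumr; congr (_ * _).
have := congr1 (fun v : 'rV_n => v ord0 b) (mulmxKV met_unit w).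
by rewrite !mxE => <-; apply: eq_bigr.
Qed.

Lemma christoffel_metric i a b : dmet g c q i a b =
  \sum_l christoffel g c q l i a * met g c q l b +
  \sum_l christoffel g c q l i b * met g c q a l.
Proof.
have -> : \sum_l christoffel g c q l i b * met g c q a l =
          \sum_l christoffel g c q l i b * met g c q l a.
  by apply: eq_bigr => l _; rewrite -[in LHS](met_sym g ac cq) mxE.
rewrite !christoffel_lower (dmet_sym b a i) (dmet_sym a b i) (dmet_sym i b a).
by field.
Qed.

End levi_civita.

End manifolds.

Section horizontally_harmonic.
Variables (R : realType) (m k n : nat) (N : manifold R n).
Variables (F : foliation N) (g : metric N) (f : 'rV[R]_m * 'rV[R]_k -> N).

Let M := ('rV[R]_m * 'rV[R]_k)%type.

Definition smooth_map : Prop :=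
  continuous f /\
  forall c : chart R n N, atlas c -> smooth_on (f @^-1` cdom c) (cmap c \o f).

Definition projH (v : M) : M := (v.1, 0).

Definition frameH (i : 'I_m) : M := (delta_mx ord0 i, 0).
Definition frameV (a : 'I_k) : M := (0, delta_mx ord0 a).

Section in_chart.
Variable c : chart R n N.

Definition df (p v : M) : 'rV[R]_n := 'D_v (cmap c \o f) p.

Definition dfHH (p v : M) : 'rV[R]_n := df p (projH v) *m piH F g c (f p).
Definition dfHV (p v : M) : 'rV[R]_n := df p (projH v) *m piV F g c (f p).

(* The pull-back connection, on a section s of f^-1 TN.                       *)
Definition pullback_nabla (s : M -> 'rV[R]_n) (p v : M) : 'rV[R]_n :=
  'D_v s p + gamma g c (f p) (df p v) (s p).

(* The Levi-Civita connection of the Euclidean metric is 'D_X.                *)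
Definition betaHH (p X : M) (Y : M -> M) : 'rV[R]_n :=
  pullback_nabla (fun p' => dfHH p' (Y p')) p X - dfHH p ('D_X Y p).

Definition trace_betaHH (p : M) : 'rV[R]_n :=
  \sum_i betaHH p (frameH i) (fun=> frameH i) +
  \sum_a betaHH p (frameV a) (fun=> frameV a).

Definition horizontal_tension (p : M) : 'rV[R]_n :=
  trace_betaHH p +
  \sum_i (tensTstar F g c (f p) (dfHH p (frameH i)) (dfHV p (frameH i)) +
          tensW F g c (f p) (dfHH p (frameH i)) (dfHV p (frameH i))).

End in_chart.

(* The Euler-Lagrange equation of E_{H,H}(f) = 1/2 int |df_{H,H}|^2 dV_g.     *)
Definition horizontally_harmonic : Prop :=
  forall (c : chart R n N) (p : M), atlas c -> cdom c (f p) ->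
    horizontal_tension c p = 0.

(* The value does not depend on the chart around f p.                         *)
Definition normsq_dfHH (p : M) : R :=
  let c := chart_at (f p) in
  \sum_i inner g c (f p) (dfHH c p (frameH i)) (dfHH c p (frameH i)).

End horizontally_harmonic.

Section cylinder.
Variables (R : realType) (m k : nat).

(* The norm of 'rV_n in the library is the sup norm.                          *)
Definition euclidean_norm j (x : 'rV[R]_j) : R :=
  Num.sqrt (\sum_i x ord0 i ^+ 2).

Definition cylinder (x0 : 'rV[R]_m) (y0 : 'rV[R]_k) (rho delta : R) :
    set ('rV[R]_m * 'rV[R]_k) :=
  [set p | euclidean_norm (p.1 - x0) <= rho /\ euclidean_norm (p.2 - y0) <= delta].

End cylinder.

(* Main.v *)
Require Import Defs.
From HB Require Import structures.
From mathcomp Require Import all_boot all_order all_algebra.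
From mathcomp Require Import all_classical all_reals all_analysis.
From mathcomp Require Import measurable_realfun ring lra.

Set Implicit Arguments.
Unset Strict Implicit.
Unset Printing Implicit Defensive.

Import Order.TTheory GRing.Theory Num.Theory.
Import numFieldNormedType.Exports.

Local Open Scope classical_set_scope.
Local Open Scope ring_scope.

(** The proof is the monotonicity formula for harmonic maps, applied on each
    horizontal slice [y = const] and integrated over [y].

    Conservation law.  Since [L_U g_H = 0] for vertical [U], the transverse
    metric [h = g_H] of the target is, locally, the pull-back of a metric on the
    leaf space: in an adapted chart it is annihilated by the vertical vectors
    and constant along them.  Pair the horizontal tension field with a vector
    [Z], writing [f_i] for the derivative of [f] along the [i]-th horizontal
    direction of the source.  For [Z] horizontal, the term [W] is vertical and
    drops out, [T^*] is moved onto [Z], and the Koszul formula leaves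
      [EL(Z) = sum_i (h(D_i f_i, Z) + (D_(f_i) h)(f_i, Z) - 1/2 (D_Z h)(f_i, f_i))],
    which is the Euler-Lagrange form of [1/2 int sum_i h(f_i, f_i)]
    ([tension_identity]).  For [Z] vertical, [EL(Z) = 0] by the two properties
    of [h].  Hence [EL] vanishes identically, and [EL(f_j) = 0], together with
    the symmetry of second derivatives ([schwarz]), says that the symmetric
    semidefinite tensor [S_ij = h(f_i, f_j)] satisfies
      [sum_i d_i S_ij = 1/2 d_j e], where [e = sum_i S_ii = |df_HH|^2]
    ([chart_conservation]).  As [S] does not depend on the chart, the law holds
    on the whole source ([pullback_trans_conservation]).  The leaf coordinate [y]
    of the source enters only as a parameter.

    Monotonicity on a slice.  The stress tensor [T_ij = S_ij - 1/2 delta_ij e]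
    is divergence free.  Contract it with the radial field
    [(x - x0) eta(|x - x0|^2)], where [eta] is nonincreasing and vanishes
    outside the ball of radius [rho2].  With [s = |x - x0|^2], the divergence is
      [(1 - m / 2) eta e - s eta' e + 2 eta' S(x - x0, x - x0)],
    whose last term is nonpositive, and its integral is zero
    ([integral_partial_eq0]).  For the Lipschitz profile
      [eta(s) = (max(s, rho1^2)^(-p) - rho2^(-2p))_+ / p], [p = (m - 2) / 2],
    the combination [- p eta - s eta'] equals [rho2^(2 - m)] on the large ball
    minus [rho1^(2 - m)] on the small one, which is the claim on the slice.  The
    profile is replaced by C1 profiles that lose an arbitrarily small [eps]
    ([cutoff_profile], [test_field_inequality], [ball_energy_monotone]).

    The cylinder is the product of two balls, so Tonelli's theorem integrates
    the inequality over [|y - y0| <= delta] ([cylinder_integral_le]). *)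

(** * Continuously differentiable functions and matrices *)

Section lines.
Variables (R : realType) (U : normedModType R).
Implicit Types (phi : U -> R) (q v w : U).

Lemma is_derive_line (V : normedModType R) (phi : U -> V) q v (t : R) :
  derivable phi (t *: v + q) v ->
  is_derive t 1 (fun s : R => phi (s *: v + q)) ('D_v phi (t *: v + q)).
Proof.
move=> dphi; have E : (fun h : R => h^-1 *: (phi ((h *: (1 : R) + t) *: v + q) - phi (t *: v + q)))
    = (fun h : R => h^-1 *: (phi (h *: v + (t *: v + q)) - phi (t *: v + q))).
  by apply/funext => h; rewrite [h *: 1]mulr1 scalerDl addrA.
by split; rewrite /derivable /derive /= E.
Qed.

Lemma mean_value_line phi q v (h : R) :
  (forall t : R, `|t| <= `|h| -> derivable phi (t *: v + q) v) ->
  exists2 t : R, `|t| <= `|h| & phi (h *: v + q) - phi q = h * 'D_v phi (t *: v + q).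
Proof.
move=> dphi.
have d (t : R) : `|t| <= `|h| ->
    is_derive t 1 (fun s : R => phi (s *: v + q)) ('D_v phi (t *: v + q)).
  by move=> th; apply: is_derive_line; exact: dphi.
have c (a b : R) : (forall t : R, t \in `[a, b] -> `|t| <= `|h|) ->
    {within `[a, b], continuous (fun s : R => phi (s *: v + q))}.
  by move=> ab; apply: derivable_within_continuous => t /ab th; have [] := d t th.
have [h0|h0] := leP 0 h.
  have sub (t : R) : t \in `[0, h] -> `|t| <= `|h|.
    by rewrite in_itv/= => /andP[t0 th]; rewrite !ger0_norm.
  have [|t th E] := @MVT_segment R (fun s => phi (s *: v + q))
      (fun t => 'D_v phi (t *: v + q)) 0 h h0 _ (c _ _ sub).
    by move=> t th; apply/d/sub; exact: subset_itv_oo_cc.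
  exists t; first exact: sub.
  by move: E; rewrite scale0r add0r subr0 mulrC.
have sub (t : R) : t \in `[h, 0] -> `|t| <= `|h|.
  by rewrite in_itv/= => /andP[th t0]; rewrite !ler0_norm ?lerN2 // ltW.
have [|t th E] := @MVT_segment R (fun s => phi (s *: v + q))
    (fun t => 'D_v phi (t *: v + q)) h 0 (ltW h0) _ (c _ _ sub).
  by move=> t th; apply/d/sub; exact: subset_itv_oo_cc.
exists t; first exact: sub.
by move: E; rewrite scale0r add0r sub0r mulrN mulrC => E; rewrite -opprB E opprK.
Qed.

End lines.

Section continuity_at.
Variable R : realType.

Lemma continuous_atM (T : topologicalType) (f g : T -> R) (x : T) :
  {for x, continuous f} -> {for x, continuous g} ->
  {for x, continuous (fun y => f y * g y)}.
Proof. by move=> cf cg; apply: cvgM; [exact: cf|exact: cg]. Qed.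

Lemma continuous_atD (T : topologicalType) (f g : T -> R) (x : T) :
  {for x, continuous f} -> {for x, continuous g} ->
  {for x, continuous (fun y => f y + g y)}.
Proof. by move=> cf cg; apply: cvgD; [exact: cf|exact: cg]. Qed.

Lemma continuous_at_cst (T : topologicalType) (a : R) (x : T) :
  {for x, continuous (fun=> a)}.
Proof. exact: cvg_cst. Qed.

Lemma continuous_at_sum (T : topologicalType) (I : Type) (r : seq I)
    (f : I -> T -> R) (x : T) : (forall i, {for x, continuous (f i)}) ->
  {for x, continuous (fun y => \sum_(i <- r) f i y)}.
Proof.
move=> cf; apply: cvg_big => [|i _]; first exact: add_continuous.
exact: cf.
Qed.

End continuity_at.

Section C1.
Variables (R : realType) (U : normedModType R).
Implicit Types (A : set U) (phi psi : U -> R) (x v : U).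

Definition C1_on A phi := forall x, A x -> {for x, continuous phi} /\
  forall v, derivable phi x v /\ {for x, continuous ('D_v phi)}.

Lemma near_eq_continuous_at (T V : topologicalType) (f g : T -> V) (x : T) :
  (\near x, f x = g x) -> {for x, continuous f} -> {for x, continuous g}.
Proof.
move=> fg cf; rewrite /prop_for /continuous_at -(nbhs_singleton fg).
exact: (cvg_trans (near_eq_cvg fg) cf).
Qed.

Lemma open_near (T : topologicalType) (A : set T) (x : T) : open A -> A x -> \near x, A x.
Proof. by move=> oA Ax; exact: open_nbhs_nbhs. Qed.

Lemma C1_on_eq A phi psi : open A -> (forall x, A x -> phi x = psi x) ->
  C1_on A phi -> C1_on A psi.
Proof.
move=> oA E C x Ax; have [cx dx] := C x Ax.
have nE : \near x, phi x = psi x by apply: filterS (open_near oA Ax).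
split; first exact: near_eq_continuous_at nE cx.
move=> v; have [d c] := dx v; split; first exact: near_eq_derivable nE d.
apply: near_eq_continuous_at c.
apply: filterS (open_near oA Ax) => y Ay.
by apply: near_eq_derive; apply: filterS (open_near oA Ay).
Qed.

Lemma C1_on_cst A (a : R) : C1_on A (fun=> a).
Proof.
move=> x _; split; first exact: cvg_cst.
move=> v; split; first exact: derivable_cst.
have -> : 'D_v (fun _ : U => a) = fun=> 0 by apply/funext => y; exact: derive_cst.
exact: cvg_cst.
Qed.

Lemma C1_onD A phi psi : open A -> C1_on A phi -> C1_on A psi ->
  C1_on A (fun x => phi x + psi x).
Proof.
move=> oA C1 C2 x Ax; have [c1 d1] := C1 x Ax; have [c2 d2] := C2 x Ax.
split; first exact: (continuous_atD c1 c2).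
move=> v; have [e1 f1] := d1 v; have [e2 f2] := d2 v.
split; first exact: (derivableD e1 e2).
apply: (@near_eq_continuous_at _ _ (fun y => 'D_v phi y + 'D_v psi y)).
  apply: filterS (open_near oA Ax) => y Ay; apply/esym; apply: deriveD.
    exact: ((C1 y Ay).2 v).1.
  exact: ((C2 y Ay).2 v).1.
exact: (continuous_atD f1 f2).
Qed.

Lemma C1_onM A phi psi : open A -> C1_on A phi -> C1_on A psi ->
  C1_on A (fun x => phi x * psi x).
Proof.
move=> oA C1 C2 x Ax; have [c1 d1] := C1 x Ax; have [c2 d2] := C2 x Ax.
split; first exact: (continuous_atM c1 c2).
move=> v; have [e1 f1] := d1 v; have [e2 f2] := d2 v.
split; first exact: (derivableM e1 e2).
apply: (@near_eq_continuous_at _ _ (fun y => phi y * 'D_v psi y + psi y * 'D_v phi y)).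
  apply: filterS (open_near oA Ax) => y Ay; apply/esym; apply: deriveM.
    exact: ((C1 y Ay).2 v).1.
  exact: ((C2 y Ay).2 v).1.
exact: (continuous_atD (continuous_atM c1 f2) (continuous_atM c2 f1)).
Qed.

Lemma C1_onV A phi : open A -> (forall x, A x -> phi x != 0) -> C1_on A phi ->
  C1_on A (fun x => (phi x)^-1).
Proof.
move=> oA n0 C1 x Ax; have [c1 d1] := C1 x Ax.
split; first by apply: cvgV => //; exact: n0.
move=> v; have [e1 f1] := d1 v.
split; first exact: (derivableV (n0 x Ax) e1).
apply: (@near_eq_continuous_at _ _ (fun y => - (phi y) ^- 2 *: 'D_v phi y)).
  apply: filterS (open_near oA Ax) => y Ay; apply/esym; apply: deriveV; first exact: n0.
  exact: ((C1 y Ay).2 v).1.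
apply: cvgM => //; apply: cvgN; apply: cvgV; first by rewrite expf_neq0 ?n0.
exact: cvgM.
Qed.

Lemma C1_onN A phi : open A -> C1_on A phi -> C1_on A (fun x => - phi x).
Proof.
move=> oA C; apply: (C1_on_eq oA _ (C1_onM oA (@C1_on_cst A (-1)) C)) => x _.
by rewrite mulN1r.
Qed.

Lemma C1_on_sum A (I : Type) (r : seq I) (P : pred I) (phi : I -> U -> R) :
  open A -> (forall i, P i -> C1_on A (phi i)) ->
  C1_on A (fun x => \sum_(i <- r | P i) phi i x).
Proof.
move=> oA C; elim: r => [|i r ih].
  by apply: (C1_on_eq oA _ (@C1_on_cst A 0)) => x _; rewrite big_nil.
case Pi: (P i).
  apply: (C1_on_eq oA _ (C1_onD oA (C i Pi) ih)) => x _.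
  by rewrite big_cons Pi.
by apply: (C1_on_eq oA _ ih) => x _; rewrite big_cons Pi.
Qed.

Lemma C1_on_prod A (I : Type) (r : seq I) (phi : I -> U -> R) :
  open A -> (forall i, C1_on A (phi i)) ->
  C1_on A (fun x => \prod_(i <- r) phi i x).
Proof.
move=> oA C; elim: r => [|i r ih].
  by apply: (C1_on_eq oA _ (@C1_on_cst A 1)) => x _; rewrite big_nil.
apply: (C1_on_eq oA _ (C1_onM oA (C i) ih)) => x _.
by rewrite big_cons.
Qed.

End C1.

Section C1_matrix.
Variables (R : realType) (U : normedModType R).
Implicit Types (A : set U).

Definition C1_mx_on m n A (M : U -> 'M[R]_(m, n)) :=
  forall i j, C1_on A (fun x => M x i j).

Lemma C1_mx_onM m n p A (M : U -> 'M[R]_(m, n)) (L : U -> 'M[R]_(n, p)) : open A ->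
  C1_mx_on A M -> C1_mx_on A L -> C1_mx_on A (fun x => M x *m L x).
Proof.
move=> oA CM CL i j.
have C : C1_on A (fun x => \sum_k M x i k * L x k j).
  by apply: (C1_on_sum _ oA) => k _; exact: (C1_onM oA (CM i k) (CL k j)).
by apply: (C1_on_eq oA _ C) => x _; rewrite mxE.
Qed.

Lemma C1_mx_onD m n A (M L : U -> 'M[R]_(m, n)) : open A ->
  C1_mx_on A M -> C1_mx_on A L -> C1_mx_on A (fun x => M x + L x).
Proof.
move=> oA CM CL i j; apply: (C1_on_eq oA _ (C1_onD oA (CM i j) (CL i j))) => x _.
by rewrite mxE.
Qed.

Lemma C1_mx_onN m n A (M : U -> 'M[R]_(m, n)) : open A ->
  C1_mx_on A M -> C1_mx_on A (fun x => - M x).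
Proof.
move=> oA CM i j; apply: (C1_on_eq oA _ (C1_onN oA (CM i j))) => x _.
by rewrite mxE.
Qed.

Lemma C1_mx_on_cst m n A (M : 'M[R]_(m, n)) : C1_mx_on A (fun=> M).
Proof. by move=> i j; exact: C1_on_cst. Qed.

Lemma C1_mx_on_eq m n A (M L : U -> 'M[R]_(m, n)) : open A ->
  (forall x, A x -> M x = L x) -> C1_mx_on A M -> C1_mx_on A L.
Proof. by move=> oA E C i j; apply: (C1_on_eq oA _ (C i j)) => x Ax; rewrite E. Qed.

Lemma C1_mx_on_tr m n A (M : U -> 'M[R]_(m, n)) : open A ->
  C1_mx_on A M -> C1_mx_on A (fun x => (M x)^T).
Proof. by move=> oA CM i j; apply: (C1_on_eq oA _ (CM j i)) => x _; rewrite mxE. Qed.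

Lemma C1_on_det n A (M : U -> 'M[R]_n) : open A ->
  C1_mx_on A M -> C1_on A (fun x => \det (M x)).
Proof.
move=> oA CM; apply: (C1_on_sum _ oA) => s _; apply: (C1_onM oA (@C1_on_cst _ _ A _)).
by apply: (C1_on_prod _ oA) => i; exact: CM.
Qed.

Lemma C1_mx_on_inv n A (M : U -> 'M[R]_n) : open A ->
  (forall x, A x -> M x \in unitmx) ->
  C1_mx_on A M -> C1_mx_on A (fun x => invmx (M x)).
Proof.
move=> oA uM CM i j.
have Cdet : C1_on A (fun x => (\det (M x))^-1).
  apply: (C1_onV oA) (C1_on_det oA CM) => x /uM.
  by rewrite unitmxE unitfE.
have Ccof : C1_on A (fun x => cofactor (M x) j i).
  apply: (C1_onM oA (@C1_on_cst _ _ A _)); apply: (C1_on_det oA) => a b.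
  by apply: (C1_on_eq oA _ (CM (lift j a) (lift i b))) => x _; rewrite !mxE.
apply: (C1_on_eq oA _ (C1_onM oA Cdet Ccof)) => x Ax.
by rewrite /invmx uM // !mxE.
Qed.

Lemma C1_mx_derivable m n A (M : U -> 'M[R]_(m, n)) x v :
  C1_mx_on A M -> A x -> derivable M x v.
Proof.
move=> C Ax; apply/derivable_mxP => i j.
exact: ((C i j x Ax).2 v).1.
Qed.

Lemma deriveMmx m n p (M : U -> 'M[R]_(m, n)) (L : U -> 'M[R]_(n, p)) x v :
  derivable M x v -> derivable L x v ->
  'D_v (fun x => M x *m L x) x = 'D_v M x *m L x + M x *m 'D_v L x.
Proof.
move=> dM dL; have eM := (derivable_mxP _ _ _).1 dM; have eL := (derivable_mxP _ _ _).1 dL.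
have E i j : is_derive x v (fun y => (M y *m L y) i j)
    (\sum_k (M x i k *: 'D_v (fun y => L y k j) x + L x k j *: 'D_v (fun y => M y i k) x)).
  rewrite (_ : (fun y => _) = \sum_k (fun y => M y i k) * (fun y => L y k j)).
    apply: is_derive_sum => k; apply: is_deriveM; exact: derivableP.
  by apply/funext => y; rewrite mxE fct_sumE.
rewrite derive_mx; last first.
  by apply/derivable_mxP => i j; have [] := E i j.
apply/matrixP => i j; rewrite !mxE (derive_val (is_derive := E i j)).
rewrite big_split addrC /=; congr (_ + _); apply: eq_bigr => k _.
  by rewrite derive_mx // mxE.
by rewrite derive_mx // mxE [RHS]mulrC.
Qed.

Lemma derivable_mulmx m n p (M : U -> 'M[R]_(m, n)) (L : U -> 'M[R]_(n, p)) x v :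
  derivable M x v -> derivable L x v -> derivable (fun x => M x *m L x) x v.
Proof.
move=> dM dL; have eM := (derivable_mxP _ _ _).1 dM; have eL := (derivable_mxP _ _ _).1 dL.
apply/derivable_mxP => i j.
rewrite (_ : (fun y => _) = \sum_k (fun y => M y i k) * (fun y => L y k j)).
  by apply: derivable_sum => k; apply: derivableM.
by apply/funext => y; rewrite mxE fct_sumE.
Qed.

End C1_matrix.

(** * Total differentiability, chain rule, symmetry of second derivatives *)

Section neighborhoods.
Variables (R : realType) (U : normedModType R).

Lemma near0_ball (P : U -> Prop) (d : R) : 0 < d -> (forall h, `|h| < d -> P h) ->
  \forall h \near (0 : U), P h.
Proof. by move=> d0 H; near=> h; apply: H; near: h; exact: nbhs0_lt.
Unshelve. all: by end_near. Qed.

(** The finitely many partial derivatives share one radius on which they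
    vary by at most [eta]. *)
Lemma C1_on_ball (A : set U) (phi : U -> R) x (I : finType) (e : I -> U) (eta : R) :
  open A -> C1_on A phi -> A x -> 0 < eta -> exists2 d : R, 0 < d & forall y, `|y| < d ->
    A (y + x) /\ forall i, `|'D_(e i) phi (y + x) - 'D_(e i) phi x| <= eta.
Proof.
move=> oA C Ax eta0.
have : \forall y \near x, A y /\ forall i, `|'D_(e i) phi y - 'D_(e i) phi x| <= eta.
  apply: filterI; first exact: open_near.
  apply: filter_forall => i; have [_ /(_ (e i))[_ c]] := C x Ax.
  have /cvgrPdist_le/(_ _ eta0) := c.
  by apply: filterS => y; rewrite distrC.
move=> /nbhs_ballP[d /= d0 Hd]; exists d => // y yd; apply: Hd.
by rewrite -ball_normE /= opprD addrCA subrr addr0 normrN.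
Qed.

End neighborhoods.

Section chain_rule.
Variables (R : realType) (n : nat).

Lemma continuous_coord (i : 'I_n) : continuous (fun x : 'rV[R]_n => x ord0 i).
Proof. by move=> x; refine (@coord_continuous _ 1 n ord0 i x). Qed.

(** The increment [phi (h + x) - phi x] is telescoped along a path that moves
    one coordinate at a time; the mean value theorem on each segment replaces
    it by a partial derivative at a point near [x]. *)
Lemma C1_differentiable (A : set 'rV[R]_n) (phi : 'rV[R]_n -> R) x :
  open A -> C1_on A phi -> A x -> differentiable phi x.
Proof.
move=> oA C Ax; set e := fun i : 'I_n => delta_mx ord0 i : 'rV[R]_n.
pose L (h : 'rV[R]_n) : R := \sum_i h ord0 i * 'D_(e i) phi x.
have linL : linear L.
  move=> a u w; rewrite /L scaler_sumr -big_split; apply: eq_bigr => i _ /=.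
  by rewrite !mxE mulrDl -mulrA.
pose Lm := GRing.isLinear.Build _ _ _ _ _ linL.
pose LL : {linear 'rV[R]_n -> R} := HB.pack L Lm.
have cL : continuous LL.
  suff cL (h : 'rV[R]_n) : {for h, continuous L} by move=> h; exact: cL.
  apply: continuous_at_sum => i.
  by apply: continuous_atM; [exact: continuous_coord|exact: continuous_at_cst].
suff dxf : forall eps : R, 0 < eps -> \forall h \near (0 : 'rV[R]_n),
    `|phi (h + x) - (phi x + L h)| <= eps * `|h|.
  have E : 'd phi x = LL :> (_ -> _).
    by apply: diff_unique => //; apply/eqaddoP => eps /dxf.
  by apply/diff_locallyP; rewrite E; split => //; apply/eqaddoP => eps /dxf.
move=> _/posnumP[eps].
have n0 : 0 < n.+1%:R :> R by rewrite ltr0n.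
(* The error is [eta] in each of the [n] coordinates; [n.+1] covers [n = 0]. *)
pose eta := eps%:num / n.+1%:R.
have [d d0 Hd] : exists2 d : R, 0 < d & forall y : 'rV[R]_n, `|y| < d ->
    A (y + x) /\ forall i, `|'D_(e i) phi (y + x) - 'D_(e i) phi x| <= eta.
  by apply: C1_on_ball => //; rewrite divr_gt0.
apply: (near0_ball d0) => h hd.
(* The vertices of the path: the first [k] coordinates have been moved. *)
pose w k : 'rV[R]_n := \row_i (if (i < k)%N then h ord0 i else 0).
have coord_le i : `|h ord0 i| <= `|h|.
  by rewrite [leRHS]/Num.Def.normr/= mx_normrE; exact: (le_bigmax _ _ (ord0, i)).
have step (k : 'I_n) : `|phi (w k.+1 + x) - phi (w k + x) - h ord0 k * 'D_(e k) phi x| <= `|h| * eta.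
  have -> : w k.+1 = h ord0 k *: e k + w k.
    apply/rowP => i; rewrite !mxE eqxx /= ltnS leq_eqVlt (inj_eq val_inj).
    case: eqVneq => [->|_] /=; first by rewrite ltnn mulr1 addr0.
    by rewrite mulr0 add0r.
  have small (t : R) : `|t| <= `|h ord0 k| -> `|t *: e k + w k| <= `|h|.
    move=> tk; rewrite [leLHS]/Num.Def.normr/= mx_normrE bigmax_le//= => -[i j] _ /=.
    rewrite ord1 !mxE eqxx /=; case: eqVneq => [->|_] /=.
      by rewrite ltnn mulr1 addr0 (le_trans tk).
    by rewrite mulr0 add0r; case: ifP => _ //; rewrite normr0.
  have [t th|t th] := @mean_value_line _ _ phi (w k + x) (e k) (h ord0 k).
    have [At _] := Hd _ (le_lt_trans (small t th) hd).
    by have [_ /(_ (e k))[]] := C _ At; rewrite addrA.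
  rewrite !addrA => ->; rewrite -mulrBr normrM; apply: ler_pM => //.
  by have [_ ] := Hd _ (le_lt_trans (small t th) hd); exact.
have wn : w n = h by apply/rowP => i; rewrite !mxE ltn_ord.
have w0 : w 0 = 0 by apply/rowP => i; rewrite !mxE.
have -> : phi (h + x) - (phi x + L h) =
    \sum_(k < n) (phi (w k.+1 + x) - phi (w k + x) - h ord0 k * 'D_(e k) phi x).
  rewrite sumrB opprD addrA; congr (_ - _).
  rewrite -(big_mkord xpredT (fun k => phi (w k.+1 + x) - phi (w k + x))).
  by rewrite telescope_sumr // wn w0 add0r.
apply: le_trans (ler_norm_sum _ _ _) _.
apply: le_trans (ler_sum _ (fun k _ => step k)) _.
rewrite sumr_const card_ord -mulrnAr mulrC ler_wpM2r // /eta.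
rewrite -mulr_natr -mulrA ler_piMr // mulrC ler_pdivrMr // mul1r ler_nat //.
Qed.

(** Only the derivative of [F] along [v] is assumed to exist, so [F] is
    restricted to the line through [p] before the chain rule is used. *)
Lemma is_derive_comp_diff (U : normedModType R) (phi : 'rV[R]_n -> R)
    (F : U -> 'rV[R]_n) p v :
  differentiable phi (F p) -> derivable F p v ->
  is_derive p v (phi \o F) ('D_('D_v F p) phi (F p)).
Proof.
move=> dphi dF; pose G (t : R) := F (t *: v + p).
have G0 : G 0 = F p by rewrite /G scale0r add0r.
have dG : is_derive (0 : R) 1 G ('D_v F p).
  have E0 : 0 *: v + p = p by rewrite scale0r add0r.
  have d0 : derivable F (0 *: v + p) v by rewrite E0.
  by apply: (is_derive_eq (is_derive_line d0)); rewrite E0.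
have /derivable1_diffP dfG : derivable G (0 : R) 1 by have [] := dG.
have dphiG : differentiable phi (G 0) by rewrite G0.
have dc : differentiable (phi \o G) (0 : R) by exact: (differentiable_comp dfG dphiG).
have E : 'D_v (phi \o F) p = 'D_1 (phi \o G) (0 : R).
  rewrite /derive; suff -> : (fun h : R => h^-1 *: ((phi \o F) (h *: v + p) - (phi \o F) p)) =
    (fun h : R => h^-1 *: ((phi \o G) (h *: (1 : R) + 0) - (phi \o G) 0)) by [].
  by apply/funext => h /=; rewrite [h *: 1]mulr1 addr0 G0.
split.
  apply/derivable1P; apply/derivable1_diffP.
  exact: dc.
rewrite E deriveE // diff_comp //= -(@deriveE _ _ _ G) // (derive_val (is_derive := dG)).
rewrite G0 (deriveE _ dphi). reflexivity.
Qed.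

Lemma derive_sumE (phi : 'rV[R]_n -> R) z u : differentiable phi z ->
  'D_u phi z = \sum_i u ord0 i * 'D_(delta_mx ord0 i) phi z.
Proof.
move=> d; rewrite deriveE // {1}(row_sum_delta u) linear_sum.
by apply: eq_bigr => i _; rewrite linearZ /= deriveE.
Qed.

Lemma C1_on_comp (U : normedModType R) (A : set U) (B : set 'rV[R]_n)
    (phi : 'rV[R]_n -> R) (F : U -> 'rV[R]_n) :
  open A -> open B -> (forall x, A x -> {for x, continuous F}) ->
  (forall x, A x -> B (F x)) -> C1_on B phi -> C1_mx_on A F ->
  C1_on A (phi \o F).
Proof.
move=> oA oB cF AB Cphi CF x Ax; have [cphi dphi] := Cphi _ (AB x Ax).
have dd y : A y -> differentiable phi (F y).
  by move=> Ay; exact: C1_differentiable oB Cphi (AB _ Ay).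
have dF y v : A y -> derivable F y v by move=> Ay; exact: C1_mx_derivable CF Ay.
split; first exact: (@continuous_comp _ _ _ F phi x (cF x Ax) cphi).
move=> v; split; first by have [] := is_derive_comp_diff (dd _ Ax) (dF _ v Ax).
apply: (@near_eq_continuous_at _ _
  (fun y => \sum_i 'D_v (fun y => F y ord0 i) y * 'D_(delta_mx ord0 i) phi (F y))).
  apply: filterS (open_near oA Ax) => y Ay.
  rewrite (derive_val (is_derive := is_derive_comp_diff (dd _ Ay) (dF _ v Ay))).
  rewrite derive_sumE; last exact: dd.
  by apply: eq_bigr => i _; rewrite derive_mx ?mxE //; exact: dF.
apply: continuous_at_sum => i.
apply: continuous_atM; first by have [_ /(_ v)[]] := CF ord0 i x Ax.
apply: (@continuous_comp _ _ _ F ('D_(delta_mx ord0 i) phi)); first exact: cF.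
by have [] := dphi (delta_mx ord0 i).
Qed.

End chain_rule.

Section schwarz.
Variables (R : realType) (U : normedModType R).

Let second_difference (phi : U -> R) p v w (s : R) :=
  phi (s *: v + (s *: w + p)) - phi (s *: v + p) - (phi (s *: w + p) - phi p).

Lemma is_derive_translate (phi : U -> R) c y v : derivable phi (c + y) v ->
  is_derive y v (fun x => phi (c + x)) ('D_v phi (c + y)).
Proof.
move=> d; have E : (fun h : R => h^-1 *: (phi (c + (h *: v + y)) - phi (c + y))) =
    (fun h : R => h^-1 *: (phi (h *: v + (c + y)) - phi (c + y))).
  by apply/funext => h; rewrite addrCA.
by split; rewrite /derivable /derive /= E.
Qed.

(** The second difference is the increment over [s v] of
    [y |-> phi (s w + y) - phi y]; one mean value along [v] and one along [w]
    turn it into [s ^ 2] times an iterated derivative at a point near [p]. *)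
Lemma second_difference_derive (A : set U) (phi : U -> R) p v w :
  open A -> C1_on A phi -> C1_on A ('D_v phi) -> A p ->
  second_difference phi p v w s / s ^+ 2 @[s --> 0^'] --> 'D_w ('D_v phi) p.
Proof.
move=> oA C Cv Ap; apply/cvgrPdist_le => e e0.
have [_ /(_ w)[_ c]] := Cv p Ap.
have : \forall y \near p, A y /\ `|'D_w ('D_v phi) p - 'D_w ('D_v phi) y| <= e.
  by apply: filterI; [exact: (open_near oA Ap)|move/cvgrPdist_le : c; exact].
move=> /nbhs_ballP[d /= d0 Hd].
pose K := `|v| + `|w| + 1.
have K0 : 0 < K by rewrite ltr_pwDr // addr_ge0.
have dK0 : 0 < d / K by rewrite divr_gt0.
near=> s.
have s0 : s != 0 by near: s; exact: nbhs_dnbhs_neq.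
have sd : `|s| < d / K by near: s; exact: dnbhs0_lt.
have inball a b : `|a| <= `|s| -> `|b| <= `|s| -> ball p d (a *: v + (b *: w + p)).
  move=> ha hb; rewrite -ball_normE /= addrA opprD addrCA subrr addr0 normrN.
  apply: (@le_lt_trans _ _ (`|s| * K)); last by rewrite -ltr_pdivlMr.
  apply: le_trans (ler_normD _ _) _; rewrite !normrZ /K mulrDr mulrDr mulr1.
  rewrite -[leLHS]addr0; apply: lerD => //; apply: lerD; exact: ler_wpM2r.
have dphi y : ball p d y -> derivable phi y v.
  by move=> /Hd[Ay _]; have [_ /(_ v)[]] := C y Ay.
have dsub (t : R) : `|t| <= `|s| ->
    is_derive (t *: v + p) v (fun y => phi (s *: w + y) - phi y)
      ('D_v phi (s *: w + (t *: v + p)) - 'D_v phi (t *: v + p)).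
  move=> th; apply: is_deriveB.
    by apply: is_derive_translate; rewrite addrCA; exact/dphi/inball.
  by apply/derivableP/dphi; have := inball t 0 th; rewrite scale0r add0r normr0; exact.
have /= [t th|t th E] := @mean_value_line _ _ (fun y => phi (s *: w + y) - phi y) p v s.
  by have [] := dsub t th.
have /= [t' th'|t' th' E'] := @mean_value_line _ _ ('D_v phi) (t *: v + p) w s.
  have /Hd[Ay _] := inball t t' th th'; rewrite addrCA.
  by have [_ /(_ w)[]] := Cv _ Ay.
have -> : second_difference phi p v w s / s ^+ 2 = 'D_w ('D_v phi) (t' *: w + (t *: v + p)).
  rewrite /second_difference (_ : _ - _ - _ = s * (s * 'D_w ('D_v phi) (t' *: w + (t *: v + p)))).
    by rewrite mulrA -expr2 mulrC mulKf // expf_neq0.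
  rewrite -E' -(derive_val (is_derive := dsub t th)) -E.
  by rewrite (addrCA (s *: v)) !opprB; ring.
by have /Hd[_] := inball t t' th th'; rewrite (addrCA (t *: v)).
Unshelve. all: by end_near. Qed.

(** Both iterated derivatives are the limit of the second difference quotient,
    which is symmetric in the two directions. *)
Lemma schwarz (A : set U) (phi : U -> R) p v w :
  open A -> C1_on A phi -> C1_on A ('D_v phi) -> C1_on A ('D_w phi) -> A p ->
  'D_w ('D_v phi) p = 'D_v ('D_w phi) p.
Proof.
move=> oA C Cv Cw Ap.
have h1 := second_difference_derive (w := w) oA C Cv Ap.
have h2 := second_difference_derive (w := v) oA C Cw Ap.
have E : second_difference phi p w v = second_difference phi p v w.
  by apply/funext => s; rewrite /second_difference (addrCA (s *: v)); ring.
by move: h2; rewrite E => h2; exact: cvg_unique h1 h2.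
Qed.

End schwarz.

(** * Orthogonal splittings and their projections *)

Section bilinear_values.
Variables (R : comNzRingType) (n : nat).
Implicit Types (A B : 'M[R]_n) (u w : 'rV[R]_n).

Definition bil A u w : R := (u *m A *m w^T) ord0 ord0.

Lemma bilDl A u u' w : bil A (u + u') w = bil A u w + bil A u' w.
Proof. by rewrite /bil !mulmxDl mxE. Qed.

Lemma bilDr A u w w' : bil A u (w + w') = bil A u w + bil A u w'.
Proof. by rewrite /bil linearD mulmxDr mxE. Qed.

Lemma bilDm A B u w : bil (A + B) u w = bil A u w + bil B u w.
Proof. by rewrite /bil mulmxDr mulmxDl mxE. Qed.

Lemma bilNl A u w : bil A (- u) w = - bil A u w.
Proof. by rewrite /bil !mulNmx mxE. Qed.

Lemma bilZl A a u w : bil A (a *: u) w = a * bil A u w.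
Proof. by rewrite /bil -!scalemxAl mxE. Qed.

Lemma bilZr A a u w : bil A u (a *: w) = a * bil A u w.
Proof. by rewrite /bil linearZ -!scalemxAr mxE. Qed.

Lemma bilZm A a u w : bil (a *: A) u w = a * bil A u w.
Proof. by rewrite /bil -scalemxAr -scalemxAl mxE. Qed.

Lemma bil0l A w : bil A 0 w = 0.
Proof. by rewrite /bil !mul0mx mxE. Qed.

Lemma bil0m u w : bil 0 u w = 0.
Proof. by rewrite /bil mulmx0 mul0mx mxE. Qed.

Lemma bil_suml A (I : Type) (r : seq I) (F : I -> 'rV[R]_n) w :
  bil A (\sum_(i <- r) F i) w = \sum_(i <- r) bil A (F i) w.
Proof. by rewrite /bil !mulmx_suml summxE. Qed.

Lemma bil_sumr A (I : Type) (r : seq I) (F : I -> 'rV[R]_n) u :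
  bil A u (\sum_(i <- r) F i) = \sum_(i <- r) bil A u (F i).
Proof. by rewrite /bil linear_sum mulmx_sumr summxE. Qed.

Lemma bil_summ (I : Type) (r : seq I) (A : I -> 'M[R]_n) u w :
  bil (\sum_(i <- r) A i) u w = \sum_(i <- r) bil (A i) u w.
Proof. by rewrite /bil mulmx_sumr mulmx_suml summxE. Qed.

Lemma bil_tr A u w : bil A^T u w = bil A w u.
Proof.
rewrite /bil -[in RHS](trmxK (w *m A *m u^T)) [RHS]mxE; congr (fun_of_matrix _ _ _).
by rewrite !trmx_mul trmxK mulmxA.
Qed.

Lemma bilMl A B u w : bil (A *m B) u w = bil B (u *m A) w.
Proof. by rewrite /bil !mulmxA. Qed.

Lemma bilMr A B u w : bil (A *m B^T) u w = bil A u (w *m B).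
Proof. by rewrite /bil trmx_mul !mulmxA. Qed.

Lemma bilE A u w : bil A u w = \sum_i \sum_j u ord0 i * A i j * w ord0 j.
Proof.
rewrite /bil mxE exchange_big; apply: eq_bigr => j _.
by rewrite !mxE mulr_suml.
Qed.

Lemma bil_null_split A u w :
  (forall v, bil A w v = 0) -> (forall v, bil A v w = 0) ->
  bil A (u + w) (u + w) = bil A u u.
Proof. by move=> l r; rewrite bilDl bilDr l r !addr0. Qed.

Lemma bil_ext A B : (forall u w, bil A u w = bil B u w) -> A = B.
Proof.
move=> AB; apply/matrixP => i j.
have := AB (delta_mx ord0 i) (delta_mx ord0 j).
by rewrite /bil trmx_delta -!rowE -!colE !mxE.
Qed.

End bilinear_values.

Section orthogonal_splitting.
Variables (R : realFieldType) (n : nat) (G V : 'M[R]_n).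
Hypothesis symG : G^T = G.
Hypothesis posG : forall v : 'rV[R]_n, v != 0 -> 0 < bil G v v.

Let H := kermx (G *m V^T).

Lemma bil_sym u w : bil G u w = bil G w u.
Proof. by rewrite -[in LHS]symG bil_tr. Qed.

Lemma bil_eq0 (v : 'rV[R]_n) : bil G v v = 0 -> v = 0.
Proof. by move=> v0; apply/eqP/negPn/negP => /posG; rewrite v0 ltxx. Qed.

Lemma gram_unit : G \in unitmx.
Proof.
rewrite -row_free_unit -kermx_eq0; apply/eqP/row_matrixP => i; rewrite row0.
apply: bil_eq0; by rewrite /bil -row_mul mulmx_ker row0 mul0mx mxE.
Qed.

Lemma horz_orth u w : (u <= H)%MS -> (w <= V)%MS -> bil G u w = 0.
Proof.
move=> /sub_kermxP uH /submxP[D ->].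
by rewrite /bil trmx_mul mulmxA -(mulmxA u) uH mul0mx mxE.
Qed.

Lemma orth_horz (u : 'rV[R]_n) :
  (forall w : 'rV[R]_n, (w <= V)%MS -> bil G u w = 0) -> (u <= H)%MS.
Proof.
move=> h; apply/sub_kermxP; apply/rowP => j.
have := h (row j V) (row_sub _ _).
by rewrite /bil tr_row colE mulmxA -colE => E; rewrite mxE in E; rewrite mulmxA E mxE.
Qed.

Lemma horz_cap : (H :&: V)%MS = 0.
Proof.
apply/eqP; apply/rowV0P => v; rewrite sub_capmx => /andP[vH vV].
by apply: bil_eq0; exact: horz_orth.
Qed.

Lemma horz_full (u : 'rV[R]_n) : (u <= H + V)%MS.
Proof.
apply: submx_full; rewrite /row_full; apply/eqP.
have := mxrank_sum_cap H V; rewrite horz_cap mxrank0 addn0 => ->.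
rewrite mxrank_ker (eqmxMfull V^T) ?row_full_unit ?gram_unit// mxrank_tr.
by rewrite subnK // rank_leq_col.
Qed.

Definition hproj := proj_mx H V.
Definition vproj := proj_mx V H.

Lemma vert_cap : (V :&: H)%MS = 0.
Proof. by apply/eqP; rewrite -submx0 capmxC submx0 horz_cap. Qed.

Lemma hvproj (u : 'rV[R]_n) : u *m hproj + u *m vproj = u.
Proof. by apply: add_proj_mx; rewrite ?horz_cap // horz_full. Qed.

Lemma hproj_sub (u : 'rV[R]_n) : (u *m hproj <= H)%MS.
Proof. exact: proj_mx_sub. Qed.

Lemma vproj_sub (u : 'rV[R]_n) : (u *m vproj <= V)%MS.
Proof. exact: proj_mx_sub. Qed.

Lemma hproj_id (u : 'rV[R]_n) : (u <= H)%MS -> u *m hproj = u.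
Proof. by apply: proj_mx_id; exact: horz_cap. Qed.

Lemma hproj_0 (u : 'rV[R]_n) : (u <= V)%MS -> u *m hproj = 0.
Proof. by apply: proj_mx_0; exact: horz_cap. Qed.

Lemma hproj_unique (u a b : 'rV[R]_n) : u = a + b -> (a <= H)%MS -> (b <= V)%MS ->
  u *m hproj = a.
Proof. by move=> -> aH bV; rewrite mulmxDl hproj_id // hproj_0 // addr0. Qed.

Lemma hproj_idem : hproj *m hproj = hproj.
Proof. by apply/row_matrixP => i; rewrite !rowE mulmxA hproj_id // hproj_sub. Qed.

Lemma bil_hproj u w : bil G (u *m hproj) (w *m hproj) = bil G (u *m hproj) w.
Proof.
rewrite -[in RHS](hvproj w) bilDr [X in _ = _ + X]horz_orth ?addr0 //.
  exact: hproj_sub.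
exact: vproj_sub.
Qed.

Lemma gram_hproj : hproj *m G *m hproj^T = hproj *m G.
Proof. by apply: bil_ext => u w; rewrite bilMr !bilMl bil_hproj. Qed.

Lemma hproj_sym : G *m hproj^T = hproj *m G.
Proof.
apply: bil_ext => u w; rewrite bilMr bilMl -bil_hproj.
by rewrite [LHS]bil_sym -[LHS]bil_hproj bil_sym.
Qed.

(** The orthogonal projection onto a coordinate subspace is a rational function
    of the Gram matrix, which makes the projections of an adapted chart as
    regular as the metric.  The compression [D *m G *m D] is invertible only on
    the subspace; [K] extends it by the identity of the complementary
    coordinate subspace. *)
Lemma hproj_formula (D : 'M[R]_n) : D *m D = D -> D^T = D -> (V :=: D)%MS ->
  let K := D *m G *m D + (1%:M - D) in
  K \in unitmx /\ hproj = 1%:M - G *m D *m invmx K.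
Proof.
move=> DD DT VD K.
have CK : D *m K = K *m D.
  by rewrite /K mulmxDr mulmxDl mulmxBr mulmxBl mulmx1 mul1mx !mulmxA DD -!mulmxA DD.
have DK : D *m K = D *m G *m D.
  by rewrite /K mulmxDr mulmxBr mulmx1 !mulmxA DD subrr addr0.
have uK : K \in unitmx.
  rewrite -row_free_unit -kermx_eq0; apply/eqP/row_matrixP => i; rewrite row0.
  set v := row i _; have vK : v *m K = 0 by rewrite /v -row_mul mulmx_ker row0.
  have vD : v *m D = v.
    have e : 1%:M - D = K - K *m D by rewrite -CK DK /K addrAC subrr add0r.
    apply/esym/subr0_eq; rewrite -[X in X - _]mulmx1 -mulmxBr e mulmxBr mulmxA.
    by rewrite vK mul0mx subr0.
  apply: bil_eq0; have -> : bil G v v = bil (D *m G *m D^T) v v by rewrite bilMr bilMl vD.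
  by rewrite DT -DK CK bilMl vK bil0l.
split => //; apply/row_matrixP => i; rewrite !rowE.
set u := delta_mx _ _; rewrite mulmxBr mulmx1.
have CKi : D *m invmx K = invmx K *m D.
  by rewrite -[LHS]mul1mx -(mulVmx uK) -!mulmxA (mulmxA K) -CK -!mulmxA mulmxV // mulmx1.
have bD : u *m (G *m D *m invmx K) *m D = u *m (G *m D *m invmx K).
  by rewrite -!mulmxA -CKi (mulmxA D) DD.
apply: (@hproj_unique _ _ (u *m (G *m D *m invmx K))); first by rewrite subrK.
  apply: orth_horz => w; rewrite VD => /submxP[w' ->].
  rewrite -bilMr DT /bil.
  suff -> : (u - u *m (G *m D *m invmx K)) *m (G *m D) = 0 by rewrite mul0mx mxE.
  rewrite mulmxBl -bD -[X in _ - X]mulmxA [X in _ - _ *m X]mulmxA -DK CK.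
  by rewrite !mulmxA (mulmxKV uK) -!mulmxA DD subrr.
by rewrite VD -bD submxMl.
Qed.

End orthogonal_splitting.

(** [J] is an isometry that maps [V] onto [V'], so it maps the orthogonal
    complement of [V] into that of [V'] and intertwines the two projections. *)
Lemma bil_hproj_change (R : realFieldType) n (G V G' V' J : 'M[R]_n) :
  (forall v : 'rV[R]_n, v != 0 -> 0 < bil G v v) ->
  (forall v : 'rV[R]_n, v != 0 -> 0 < bil G' v v) ->
  G = J *m G' *m J^T -> (V' :=: V *m J)%MS -> forall u w,
  bil G (u *m hproj G V) (w *m hproj G V) =
  bil G' (u *m J *m hproj G' V') (w *m J *m hproj G' V').
Proof.
move=> pG pG' GJ VJ.
have E (u : 'rV[R]_n) : u *m J *m hproj G' V' = u *m hproj G V *m J.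
  apply: (hproj_unique pG' (b := u *m vproj G V *m J)).
  - by rewrite -mulmxDl hvproj.
  - apply: orth_horz => w; rewrite VJ => /submxP[x ->].
    rewrite (mulmxA x) -(bilMl J) -(bilMr _ J) -GJ; apply: (horz_orth (V := V)).
      exact: hproj_sub.
    by rewrite submxMl.
  - have /submxP[x ->] := vproj_sub G V u.
    by rewrite VJ -mulmxA submxMl.
by move=> u w; rewrite !E -(bilMl J) -(bilMr _ J) -GJ.
Qed.

(** * Calculus of smooth matrix-valued functions *)

Section smooth_matrix.
Variables (R : realType) (U : normedModType R).

Lemma continuous_mx_coord a b (M : U -> 'M[R]_(a, b)) x i j :
  {for x, continuous M} -> {for x, continuous (fun y => M y i j)}.
Proof.
move=> cM; apply: (@continuous_comp _ _ _ M (fun N : 'M[R]_(a, b) => N i j)) => //.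
exact: coord_continuous.
Qed.

Lemma smooth_on_derive (V : normedModType R) (A : set U) (f : U -> V) v :
  smooth_on A f -> smooth_on A ('D_v f).
Proof. by move=> sf j; have [_ /(_ v)[]] := sf j.+1. Qed.

Lemma smooth_on_continuous (V : normedModType R) (A : set U) (f : U -> V) :
  smooth_on A f -> forall x, A x -> {for x, continuous f}.
Proof. by move=> sf; have [] := sf 0. Qed.

Lemma smooth_on_C1 a b (A : set U) (M : U -> 'M[R]_(a, b)) : open A ->
  smooth_on A M -> C1_mx_on A M.
Proof.
move=> oA sM i j x Ax; have [cM dM] := sM 1%N.
split; first by apply: continuous_mx_coord; exact: cM.
move=> v; have [dv [cv _]] := dM v.
split; first by have /derivable_mxP := dv x Ax.
apply: (@near_eq_continuous_at _ _ (fun y => 'D_v M y i j)).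
  apply: filterS (open_near oA Ax) => y Ay.
  by rewrite derive_mx ?mxE //; exact: dv.
by apply: continuous_mx_coord; exact: cv.
Qed.

Lemma smooth_on_cst (V : normedModType R) (A : set U) (a : V) : smooth_on A (fun=> a).
Proof.
move=> j; elim: j a => [|j ih] a.
  by split => // x _; exact: cvg_cst.
split; first by move=> x _; exact: cvg_cst.
move=> v; split; first by move=> x _; exact: derivable_cst.
have -> : 'D_v (fun _ : U => a) = fun=> 0 by apply/funext => y; exact: derive_cst.
exact: ih.
Qed.

(** Entry by entry, the derivative of [M] along [F] depends only on the velocity
    of [F]. *)
Lemma is_derive_comp_mx n a b (B : set 'rV[R]_n) (M : 'rV[R]_n -> 'M[R]_(a, b))
    (F : U -> 'rV[R]_n) p v :
  open B -> C1_mx_on B M -> B (F p) -> derivable F p v ->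
  is_derive p v (M \o F) ('D_('D_v F p) M (F p)).
Proof.
move=> oB CM BF dF.
have dd i j := is_derive_comp_diff (C1_differentiable oB (CM i j) BF) dF.
have d : derivable (M \o F) p v.
  by apply/derivable_mxP => i j; have [] := dd i j.
have dM := C1_mx_derivable (v := 'D_v F p) CM BF.
split; first exact: d.
rewrite (derive_mx d) (derive_mx dM).
by apply/matrixP => i j; rewrite !mxE; exact: (derive_val (is_derive := dd i j)).
Qed.

Lemma derive_tr a b (M : U -> 'M[R]_(a, b)) x v : derivable M x v ->
  derivable (fun y => (M y)^T) x v /\ 'D_v (fun y => (M y)^T) x = ('D_v M x)^T.
Proof.
move=> dM; have E i j : (fun y => (M y)^T i j) = (fun y => M y j i).
  by apply/funext => y; rewrite mxE.
have dT : derivable (fun y => (M y)^T) x v.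
  by apply/derivable_mxP => i j; rewrite E; have /derivable_mxP := dM.
by split => //; apply/matrixP => i j; rewrite !derive_mx // !mxE E.
Qed.

Lemma derive_mull a b d (N : 'M[R]_(a, b)) (M : U -> 'M[R]_(b, d)) x v :
  derivable M x v -> 'D_v (fun y => N *m M y) x = N *m 'D_v M x.
Proof.
move=> dM; have dN : derivable (fun _ : U => N) x v by exact: derivable_cst.
by rewrite (deriveMmx dN dM) derive_cst mul0mx add0r.
Qed.

Lemma derive_bil n (A : U -> 'M[R]_n) (f g : U -> 'rV[R]_n) x v :
  derivable A x v -> derivable f x v -> derivable g x v ->
  is_derive x v (fun y => bil (A y) (f y) (g y))
    (bil (A x) ('D_v f x) (g x) + bil ('D_v A x) (f x) (g x) + bil (A x) (f x) ('D_v g x)).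
Proof.
move=> dA df dg; have [dgT EgT] := derive_tr dg.
have dfA := derivable_mulmx df dA.
have d := derivable_mulmx dfA dgT.
have E := deriveMmx dfA dgT.
split; first by have /derivable_mxP := d; exact.
have := congr1 (fun N : 'M[R]_1 => N ord0 ord0) E.
rewrite derive_mx // [LHS]mxE => ->.
by rewrite deriveMmx // EgT mulmxDl /bil !mxE.
Qed.

End smooth_matrix.

Lemma derive_sum_mx (R : realType) n a b (B : set 'rV[R]_n) (M : 'rV[R]_n -> 'M[R]_(a, b)) z u :
  open B -> C1_mx_on B M -> B z ->
  'D_u M z = \sum_i u ord0 i *: 'D_(delta_mx ord0 i) M z.
Proof.
move=> oB CM Bz; have dM v : derivable M z v by exact: C1_mx_derivable CM Bz.
rewrite derive_mx //; apply/matrixP => i j; rewrite mxE summxE.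
rewrite derive_sumE; last exact: C1_differentiable oB (CM i j) Bz.
by apply: eq_bigr => k _; rewrite mxE derive_mx // mxE.
Qed.

(** * The transverse metric in a chart adapted to the foliation *)

Lemma mulmx_sandwich0 (R : pzRingType) n (x : 'rV[R]_n) (A B C : 'M[R]_n) :
  A *m B *m C = 0 -> x *m A = x -> x *m B *m C = 0.
Proof. by move=> E xA; rewrite -xA -!mulmxA mulmxA -mulmxA (mulmxA A) E mulmx0. Qed.

(** The linear algebra of the Koszul formula, [uwZ] being the value at [Z] of
    the connection applied to [u] and [w]: metric compatibility and vanishing
    torsion determine it. *)
Lemma koszul_scalars (R : realFieldType) (du dw dz uwZ uZw wuZ wZu Zuw Zwu : R) :
  du = uwZ + uZw -> dw = wuZ + wZu -> dz = Zuw + Zwu ->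
  wuZ = uwZ -> Zuw = uZw -> Zwu = wZu -> uwZ = 2^-1 * (du + dw - dz).
Proof. by move=> -> -> -> -> -> ->; field. Qed.

(** The cancellations of [tension_identity].  In the names, [gaBC] is the value
    at [B], [C] of the derivative of the metric along [a], and [y = X + U]. *)
Lemma tension_scalars (R : realFieldType)
    (ha yy yZ t1 t2 t3 t4 gyXZ gXXZ gXyZ gXUZ gXZU gZyX gZXX gZUX gZXU gUXZ : R) :
  t1 = yZ - gyXZ -> t2 = 2^-1 * (gyXZ + gXyZ - gZyX) -> t3 = - gXZU ->
  t4 = 2^-1 * (gXZU + gZXU - gUXZ) -> gUXZ = 0 -> yy = gZXX -> gyXZ = gXXZ ->
  gXyZ = gXXZ + gXUZ -> gZyX = gZXX + gZUX -> gXUZ = gXZU -> gZUX = gZXU ->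
  ha + t1 + t2 + (t3 + t4) = ha + yZ - 2^-1 * yy.
Proof. by move=> -> -> -> -> -> -> -> -> -> -> ->; field. Qed.

Section chart_geometry.
Variables (R : realType) (n : nat) (N : manifold R n) (F : foliation N) (g : metric N).
Variable c : chart R n N.
Hypothesis ac : atlas c.

Let A := cmap c @` cdom c.
Let G (z : 'rV[R]_n) := met g c (cinv c z).
Let P (z : 'rV[R]_n) := piH F g c (cinv c z).
(* The Gram matrix of the transverse metric: [P *m G = P *m G *m P^T] because *)
(* [P] is self-adjoint.                                                      *)
Let h (z : 'rV[R]_n) := P z *m G z.

Lemma cinv_dom z : A z -> cdom c (cinv c z).
Proof. by case=> q cq <-; rewrite cmapK. Qed.

Lemma cmap_cinv z : A z -> cmap c (cinv c z) = z.
Proof. by case=> q cq <-; rewrite cmapK. Qed.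

Lemma gram_pos q : cdom c q -> forall v : 'rV[R]_n, v != 0 -> 0 < bil (met g c q) v v.
Proof. by move=> cq v; exact: met_pos. Qed.

Lemma gram_sym q : cdom c q -> (met g c q)^T = met g c q.
Proof. by move=> cq; exact: met_sym. Qed.

Lemma piHE q : piH F g c q = hproj (met g c q) (vert F c q). Proof. by []. Qed.
Lemma piVE q : piV F g c q = vproj (met g c q) (vert F c q). Proof. by []. Qed.

Lemma gram_C1 : C1_mx_on A G.
Proof. apply: smooth_on_C1; [exact: cimg_open|exact: met_smooth]. Qed.

Lemma derive_gram_tr z v : A z -> ('D_v G z)^T = 'D_v G z.
Proof.
move=> Az; have dG := C1_mx_derivable (v := v) gram_C1 Az.
have [_ <-] := derive_tr dG; apply: near_eq_derive.
by apply: filterS (open_near (@cimg_open _ _ _ c) Az) => y Ay; exact/gram_sym/cinv_dom.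
Qed.

Lemma dmetE q i a b : cdom c q ->
  dmet g c q i a b = 'D_(delta_mx ord0 i) G (cmap c q) a b.
Proof.
move=> cq; rewrite derive_mx ?mxE //.
by apply: C1_mx_derivable gram_C1 _; exists q.
Qed.

Let C q (u w Z : 'rV[R]_n) := bil (met g c q) (gamma g c q u w) Z.

Let CE q u w Z : C q u w Z =
  \sum_i \sum_a \sum_b u ord0 i * w ord0 a * Z ord0 b *
    (\sum_l christoffel g c q l i a * met g c q l b).
Proof.
rewrite /C bilE.
under eq_bigr do under eq_bigr do rewrite mxE !mulr_suml.
under eq_bigr do rewrite exchange_big /=.
rewrite exchange_big /=; apply: eq_bigr => i _.
under eq_bigr do under eq_bigr do rewrite !mulr_suml.
under eq_bigr do rewrite exchange_big /=.
rewrite exchange_big /=; apply: eq_bigr => a _.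
rewrite exchange_big /=; apply: eq_bigr => b _.
by rewrite mulr_sumr; apply: eq_bigr => l _; ring.
Qed.

Let C_sym q u w Z : cdom c q -> C q u w Z = C q w u Z.
Proof.
move=> cq; rewrite !CE exchange_big; apply: eq_bigr => i _; apply: eq_bigr => a _.
apply: eq_bigr => b _; rewrite (mulrC (u _ _)); congr (_ * _).
by apply: eq_bigr => l _; rewrite christoffel_torsion_free.
Qed.

Let C_metric q u w Z : cdom c q ->
  bil ('D_u G (cmap c q)) w Z = C q u w Z + C q u Z w.
Proof.
move=> cq; have Aq : A (cmap c q) by exists q.
rewrite (derive_sum_mx _ (@cimg_open _ _ _ c) gram_C1 Aq) bil_summ.
rewrite !CE -big_split; apply: eq_bigr => i _ /=.
rewrite bilZm bilE mulr_sumr [X in _ = _ + X]exchange_big -big_split.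
apply: eq_bigr => a _ /=; rewrite mulr_sumr -big_split; apply: eq_bigr => b _ /=.
rewrite -dmetE // christoffel_metric //.
under [X in _ + X]eq_bigr => l _ do rewrite -[met g c q]gram_sym // mxE.
by ring.
Qed.

(** The Koszul formula, for vector fields with constant components. *)
Lemma koszul q u w Z : cdom c q -> bil (met g c q) (gamma g c q u w) Z =
  2^-1 * (bil ('D_u G (cmap c q)) w Z + bil ('D_w G (cmap c q)) u Z
          - bil ('D_Z G (cmap c q)) u w).
Proof.
move=> cq; exact: koszul_scalars (C_metric u w Z cq) (C_metric w u Z cq)
  (C_metric Z u w cq) (C_sym w u Z cq) (C_sym Z u w cq) (C_sym Z w u cq).
Qed.

Hypothesis adapted : forall q, cdom c q -> (vert F c q :=: copid_mx (codim F))%MS.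

Let D : 'M[R]_n := copid_mx (codim F).

Let DD : D *m D = D. Proof. exact: copid_mx_id (codim_le F). Qed.
Let DT : D^T = D. Proof. by rewrite /D /copid_mx linearB /= trmx1 tr_pid_mx. Qed.

Let oA : open A. Proof. exact: cimg_open. Qed.

Let gpos z (Az : A z) : forall v : 'rV[R]_n, v != 0 -> 0 < bil (G z) v v.
Proof. exact/gram_pos/cinv_dom. Qed.

Let gsym z (Az : A z) : (G z)^T = G z.
Proof. exact/gram_sym/cinv_dom. Qed.

Lemma piH_C1 : C1_mx_on A P.
Proof.
pose K z := D *m G z *m D + (1%:M - D).
have cst := @C1_mx_on_cst R 'rV[R]_n n n A.
have F1 z : A z -> K z \in unitmx /\ P z = 1%:M - G z *m D *m invmx (K z).
  move=> Az; have := hproj_formula (gpos Az) DD DT (adapted (cinv_dom Az)).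
  by rewrite -piHE.
apply: (C1_mx_on_eq (M := fun z => 1%:M - G z *m D *m invmx (K z)) oA).
  by move=> z /F1[].
have CGD := C1_mx_onM oA gram_C1 (cst D).
have CK : C1_mx_on A K.
  apply: (C1_mx_onD oA _ (cst _)).
  exact: (C1_mx_onM oA (C1_mx_onM oA (cst D) gram_C1) (cst D)).
have Ci := C1_mx_on_inv oA (fun z Az => (F1 z Az).1) CK.
exact: (C1_mx_onD oA (cst _) (C1_mx_onN oA (C1_mx_onM oA CGD Ci))).
Qed.

Lemma trans_C1 : C1_mx_on A h.
Proof. exact: (C1_mx_onM oA piH_C1 gram_C1). Qed.

Lemma trans_sym z : A z -> (h z)^T = h z.
Proof.
move=> Az; rewrite /h trmx_mul gsym //.
exact: (hproj_sym _ (gsym Az) (gpos Az)).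
Qed.

Lemma vert_piH z (U : 'rV[R]_n) : A z -> (U <= D)%MS -> U *m P z = 0.
Proof.
by move=> Az UD; apply: hproj_0; [exact: gpos|rewrite adapted //; exact: cinv_dom].
Qed.

Lemma derive_trans_tr z v : A z -> ('D_v h z)^T = 'D_v h z.
Proof.
move=> Az; have dh := C1_mx_derivable (v := v) trans_C1 Az.
have [_ <-] := derive_tr dh; apply: near_eq_derive.
by apply: filterS (open_near oA Az) => y Ay; exact: trans_sym.
Qed.

(** The constant vectors of [D] are vertical at every point of the chart, so they
    lie in the kernel of [h] at every point and thus in that of its derivatives. *)
Lemma derive_trans_vertl z v (U w : 'rV[R]_n) : A z -> (U <= D)%MS -> bil ('D_v h z) U w = 0.
Proof.
move=> Az UD; have dh := C1_mx_derivable (v := v) trans_C1 Az.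
rewrite /bil -derive_mull // (_ : 'D_v _ z = 0) ?mul0mx ?mxE //.
rewrite -(derive_cst (0 : 'rV[R]_n) z v); apply: near_eq_derive.
by apply: filterS (open_near oA Az) => y Ay; rewrite /h mulmxA vert_piH // mul0mx.
Qed.

Lemma derive_trans_vertr z v (U w : 'rV[R]_n) : A z -> (U <= D)%MS -> bil ('D_v h z) w U = 0.
Proof. by move=> Az UD; rewrite -bil_tr derive_trans_tr // derive_trans_vertl. Qed.

Lemma derive_transE z v : A z -> 'D_v h z = 'D_v P z *m G z + P z *m 'D_v G z.
Proof.
move=> Az; apply: deriveMmx.
  exact: C1_mx_derivable piH_C1 Az.
exact: C1_mx_derivable gram_C1 Az.
Qed.

Lemma piH_idem z : A z -> P z *m P z = P z.
Proof. by move=> Az; apply: hproj_idem; exact: gpos. Qed.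

(** Differentiate [P *m P = P]: the derivative of a projection exchanges its
    image and its kernel. *)
Lemma derive_piH_sandwich z v : A z -> P z *m 'D_v P z *m P z = 0.
Proof.
move=> Az; have dP := C1_mx_derivable (v := v) piH_C1 Az.
have E : 'D_v P z = 'D_v P z *m P z + P z *m 'D_v P z.
  rewrite -(deriveMmx dP dP); apply: near_eq_derive.
  by apply: filterS (open_near oA Az) => y Ay; rewrite piH_idem.
have E2 : P z *m (P z *m 'D_v P z) = P z *m 'D_v P z by rewrite mulmxA piH_idem.
have : P z *m 'D_v P z = P z *m ('D_v P z *m P z) + P z *m 'D_v P z.
  by rewrite -[in RHS]E2 -mulmxDr -E.
by rewrite mulmxA => /eqP; rewrite eq_sym -subr_eq0 addrK => /eqP.
Qed.

Hypothesis hF : riemannian_foliation F g.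

(** In an adapted chart the vertical fields with constant components commute with
    the coordinate fields, so that [L_U g_H = 0] says that the entries of [h] are
    constant along the leaves. *)
Lemma derive_trans_vert0 z (U : 'rV[R]_n) : A z -> (U <= D)%MS -> 'D_U h z = 0.
Proof.
move=> Az UD; have := hF ac (smooth_on_cst (U := 'rV[R]_n) _ U) _ Az.
rewrite /lie_derivative.
have -> : 'J (fun _ : 'rV[R]_n => U) z = 0.
  by rewrite /jacobian diff_cst; apply/matrixP => i j; rewrite !mxE.
rewrite mul0mx trmx0 mulmx0 !addr0 => <-.
  apply: near_eq_derive.
  apply: filterS (open_near oA Az) => y Ay.
  by rewrite /gramH -/(P y) -/(G y) gram_hproj //; exact: gpos.
by move=> y Ay; rewrite adapted //; exact: cinv_dom.
Qed.

(** In [D_v h = D_v P *m G + P *m D_v G] the first term pairs to zero on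
    horizontal vectors by [derive_piH_sandwich]. *)
Lemma derive_trans_horz z v (X Z : 'rV[R]_n) : A z ->
  X *m P z = X -> Z *m P z = Z -> bil ('D_v h z) X Z = bil ('D_v G z) X Z.
Proof.
move=> Az XP ZP; rewrite derive_transE // bilDm !bilMl XP.
rewrite -[X in bil (G z) _ X]ZP -bilMr (hproj_sym _ (gsym Az) (gpos Az)).
rewrite -[hproj _ _]/(P z) bilMl.
rewrite (mulmx_sandwich0 (derive_piH_sandwich v Az) XP).
by rewrite bil0l add0r.
Qed.

Lemma derive_gram_lin z u v : A z -> 'D_(u + v) G z = 'D_u G z + 'D_v G z.
Proof.
move=> Az; rewrite !(derive_sum_mx _ oA gram_C1 Az) -big_split.
by apply: eq_bigr => i _; rewrite mxE scalerDl.
Qed.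

Lemma derive_trans_lin z u v : A z -> 'D_(u + v) h z = 'D_u h z + 'D_v h z.
Proof.
move=> Az; rewrite !(derive_sum_mx _ oA trans_C1 Az) -big_split.
by apply: eq_bigr => i _; rewrite mxE scalerDl.
Qed.

(** On the left, the contribution of one horizontal direction of the source to
    the horizontal tension field paired with a horizontal [Z]: [y] is the
    derivative of the map in that direction, [a] its second derivative, and the
    term with [U] comes from [T^*] moved onto [Z].  The connection is expanded by
    the Koszul formula, and the derivatives of [G] are replaced by those of [h],
    which ignore the vertical part [U] of [y]; the remaining terms in [U] cancel.
    On the right, the Euler-Lagrange expression of [1/2 h(y, y)]. *)
Lemma tension_identity z (a y Z : 'rV[R]_n) : A z -> Z *m P z = Z ->
  let q := cinv c z in
  let X := y *m piH F g c q in let U := y *m piV F g c q in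
  bil (G z) (a *m P z + y *m 'D_y P z + gamma g c q y X) Z
  + bil (G z) U (Z *m 'D_X P z + gamma g c q X Z)
  = bil (h z) a Z + bil ('D_y h z) y Z - 2^-1 * bil ('D_Z h z) y y.
Proof.
move=> Az ZP q X U.
have cq : cdom c q by exact: cinv_dom.
have Eq : cmap c q = z by exact: cmap_cinv.
have yXU : y = X + U by rewrite /X /U piHE piVE hvproj //; exact: gram_pos.
have UD : (U <= D)%MS by have := vproj_sub (G z) (vert F c q) y; rewrite (adapted cq).
have XP : X *m P z = X by rewrite -[LHS]mulmxA piH_idem.
have XE : y *m P z = X by [].
clearbody X U.
have dGs v u w : bil ('D_v G z) u w = bil ('D_v G z) w u.
  by rewrite -bil_tr derive_gram_tr.
have EG : met g c q = G z by [].
rewrite !bilDl !bilDr -bilMl.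
have e2 : bil (G z) (y *m 'D_y P z) Z = bil ('D_y h z) y Z - bil ('D_y G z) X Z.
  by rewrite derive_transE // bilDm !bilMl XE addrK.
have e3 := koszul y X Z cq; rewrite Eq EG in e3.
have e4 : bil (G z) U (Z *m 'D_X P z) = - bil ('D_X G z) Z U.
  have : bil ('D_X h z) Z U = 0 by exact: derive_trans_vertr.
  rewrite derive_transE // bilDm !bilMl ZP => /eqP; rewrite addr_eq0 => /eqP <-.
  by rewrite bil_sym // gsym.
have e5 : bil (G z) U (gamma g c q X Z) = bil (G z) (gamma g c q X Z) U.
  exact: (bil_sym (gsym Az)).
rewrite -EG (koszul X Z U cq) Eq in e5; rewrite EG in e5.
have e6 : bil ('D_U G z) X Z = 0.
  by rewrite -derive_trans_horz // derive_trans_vert0 // bil0m.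
have e7 : bil ('D_Z h z) y y = bil ('D_Z G z) X X.
  have vr w : bil ('D_Z h z) w U = 0 by exact: derive_trans_vertr.
  have vl w : bil ('D_Z h z) U w = 0 by exact: derive_trans_vertl.
  rewrite {1 2}yXU; apply: (etrans (bil_null_split X vl vr)).
  exact: derive_trans_horz.
have e8 : bil ('D_y G z) X Z = bil ('D_X G z) X Z.
  have -> : 'D_y G z = 'D_X G z + 'D_U G z by rewrite -(derive_gram_lin X U Az) -yXU.
  by rewrite bilDm [X in _ + X]e6 addr0.
have e9 : bil ('D_X G z) y Z = bil ('D_X G z) X Z + bil ('D_X G z) U Z.
  by rewrite -bilDl -yXU.
have e10 : bil ('D_Z G z) y X = bil ('D_Z G z) X X + bil ('D_Z G z) U X.
  by rewrite -bilDl -yXU.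
have e11 := dGs X U Z; have e12 := dGs Z U X.
exact: (tension_scalars _ e2 e3 e4 e5 e6 e7 e8 e9 e10 e11 e12).
Qed.

End chart_geometry.

(** * The conservation law of a horizontally harmonic map, in an adapted chart *)

Section tensors.
Variables (R : realType) (n : nat) (N : manifold R n) (F : foliation N) (g : metric N).
Variable c : chart R n N.
Hypotheses (ac : atlas c)
  (adapted : forall q, cdom c q -> (vert F c q :=: copid_mx (codim F))%MS).

Lemma gammaE q (u w : 'rV[R]_n) :
  gamma g c q u w = w *m \matrix_(j, l) \sum_i christoffel g c q l i j * u ord0 i.
Proof.
apply/rowP => l; rewrite !mxE exchange_big; apply: eq_bigr => j _ /=.
by rewrite mxE mulr_sumr; apply: eq_bigr => i _; rewrite mulrC.
Qed.

Lemma tensTE q (X Z : 'rV[R]_n) : cdom c q ->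
  tensT F g c q X Z = (Z *m 'D_(X *m piH F g c q) (fun z => piH F g c (cinv c z)) (cmap c q)
    + gamma g c q (X *m piH F g c q) (Z *m piH F g c q)) *m piV F g c q.
Proof.
move=> cq; rewrite /tensT /nabla; congr ((_ + _) *m _).
rewrite -derive_mull //.
by apply: (C1_mx_derivable (piH_C1 (F := F) g ac adapted)); exists q.
Qed.

(** [tensTstar] is picked among the solutions of the adjunction identity; one
    exists because [tensT] is linear in its second argument and the metric is
    invertible. *)
Lemma tensTstarP q (X Y Z : 'rV[R]_n) : cdom c q ->
  bil (met g c q) (tensTstar F g c q X Y) Z = bil (met g c q) Y (tensT F g c q X Z).
Proof.
move=> cq; rewrite /tensTstar; case: xgetP => [w _ /(_ Z)|] //.
have gu := gram_unit (gram_pos g ac cq).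
set M := 'D_(X *m piH F g c q) (fun z => piH F g c (cinv c z)) (cmap c q) +
  piH F g c q *m \matrix_(j, l) \sum_i christoffel g c q l i j * (X *m piH F g c q) ord0 i.
have TM W : tensT F g c q X W = W *m (M *m piV F g c q).
  by rewrite tensTE // gammaE [RHS]mulmxA /M [in RHS]mulmxDr (mulmxA W).
move: TM; move: (M *m piV F g c q) => T TM.
move=> /(_ (Y *m met g c q *m T^T *m invmx (met g c q))) /=.
case=> W; rewrite TM /inner mulmxKV //.
by rewrite trmx_mul !mulmxA.
Qed.

Lemma tensW_horz q (X U Z : 'rV[R]_n) : cdom c q -> Z *m piH F g c q = Z ->
  bil (met g c q) (tensW F g c q X U) Z = 0.
Proof.
move=> cq <-; rewrite bilNl bil_sym; last exact: gram_sym.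
by rewrite (horz_orth (V := vert F c q)) ?oppr0 //; [exact: hproj_sub|exact: vproj_sub].
Qed.

End tensors.

Lemma scalarsD (R : realFieldType) (a1 a2 b1 b2 c1 c2 : R) :
  a1 + a2 + (b1 + b2) - 2^-1 * (c1 + c2) = a1 + b1 - 2^-1 * c1 + (a2 + b2 - 2^-1 * c2).
Proof. by ring. Qed.

Lemma scalars0 (R : realFieldType) : 0 + 0 - 2^-1 * 0 = 0 :> R.
Proof. by rewrite mulr0 subr0 addr0. Qed.

Lemma conservation_scalars (R : realFieldType) (x1 x2 x3 y1 y2 y3 : R) :
  x3 = y3 -> y1 = y3 ->
  x1 + x2 + x3 - 2^-1 * (y1 + y2 + y3) = x1 + x2 - 2^-1 * y2.
Proof. by move=> -> ->; field. Qed.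

Section harmonic_map.
Variables (R : realType) (m k n : nat) (N : manifold R n).
Variables (F : foliation N) (g : metric N) (f : 'rV[R]_m * 'rV[R]_k -> N).
Hypotheses (hF : riemannian_foliation F g) (hf : smooth_map f)
  (hharm : horizontally_harmonic F g f).

Let M := ('rV[R]_m * 'rV[R]_k)%type.
Implicit Types (p v : M).
Local Notation e i := (frameH R k i).

Section in_adapted_chart.
Variable c : chart R n N.
Hypotheses (ac : atlas c)
  (adapted : forall q, cdom c q -> (vert F c q :=: copid_mx (codim F))%MS).

Let B : set M := f @^-1` cdom c.
Let A := cmap c @` cdom c.
Let Fc : M -> 'rV[R]_n := cmap c \o f.
Let G (z : 'rV[R]_n) := met g c (cinv c z).
Let P (z : 'rV[R]_n) := piH F g c (cinv c z).
Let h (z : 'rV[R]_n) := P z *m G z.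

Let oA : open A. Proof. exact: cimg_open. Qed.

Let oB : open B.
Proof. by move: (hf.1) => /continuousP; apply; exact: cdom_open. Qed.

Let BA p : B p -> A (Fc p). Proof. by move=> Bp; exists (f p). Qed.

Let cinvF p : B p -> cinv c (Fc p) = f p.
Proof. by move=> Bp; rewrite /Fc /= cmapK. Qed.

Let smF : smooth_on B Fc. Proof. exact: hf.2. Qed.

Let dF p v : B p -> derivable Fc p v.
Proof. exact: (C1_mx_derivable (smooth_on_C1 oB smF)). Qed.

Let smdF i : smooth_on B (fun p => df f c p (e i)).
Proof. exact: smooth_on_derive. Qed.

Let ddF i p v : B p -> derivable (fun p => df f c p (e i)) p v.
Proof. exact: (C1_mx_derivable (smooth_on_C1 oB (smdF i))). Qed.

Let projH_e (i : 'I_m) : projH (e i) = e i. Proof. by []. Qed.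

Lemma dfHHE p i : B p -> dfHH F g f c p (e i) = df f c p (e i) *m P (Fc p).
Proof. by move=> Bp; rewrite /dfHH projH_e /P cinvF. Qed.

(** The leaf directions of the source contribute nothing to the trace, since
    [projH] kills them. *)
Lemma trace_betaHHE p : B p -> trace_betaHH F g f c p =
  \sum_i ('D_(e i) (fun p => df f c p (e i)) p *m P (Fc p) +
    df f c p (e i) *m 'D_(df f c p (e i)) P (Fc p) +
    gamma g c (f p) (df f c p (e i)) (dfHH F g f c p (e i))).
Proof.
move=> Bp.
have df0 p' : df f c p' 0 = 0 by exact: derive0.
rewrite /trace_betaHH [X in _ + X]big1 ?addr0; last first.
  move=> a _; rewrite /betaHH /pullback_nabla.
  have dV p' : dfHH F g f c p' (frameV R m a) = 0.
    by rewrite /dfHH (_ : projH _ = 0) // df0 mul0mx.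
  rewrite (_ : (fun p' => _) = fun=> 0); last by apply/funext => p'; exact: dV.
  rewrite !derive_cst /dfHH (_ : projH 0 = 0) // df0 mul0mx subr0 add0r.
  by rewrite gammaE mul0mx.
apply: eq_bigr => i _; rewrite /betaHH /pullback_nabla derive_cst.
rewrite [X in _ - X]/dfHH (_ : projH 0 = 0) // df0 mul0mx subr0; congr (_ + _).
have dPF := is_derive_comp_mx oA (piH_C1 (F := F) g ac adapted) (BA Bp) (@dF p (e i) Bp).
transitivity ('D_(e i) (fun p' => df f c p' (e i) *m (P \o Fc) p') p).
  by apply: near_eq_derive; apply: filterS (open_near oB Bp) => p' Bp'; exact: dfHHE.
have dPFd : derivable (P \o Fc) p (e i) by have [] := dPF.
by rewrite (deriveMmx (@ddF i p (e i) Bp) dPFd) (derive_val (is_derive := dPF)).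
Qed.

(** The Euler-Lagrange expression of the transverse energy, as a linear form in [Z]. *)
Let EL p Z := \sum_i (bil (h (Fc p)) ('D_(e i) (fun p => df f c p (e i)) p) Z
  + bil ('D_(df f c p (e i)) h (Fc p)) (df f c p (e i)) Z
  - 2^-1 * bil ('D_Z h (Fc p)) (df f c p (e i)) (df f c p (e i))).

(** [W] takes vertical values, hence pairs to zero with [Z], and [T^*] is moved
    onto [Z]; what remains is [tension_identity] summed over the frame. *)
Let EL_horz p Z : B p -> Z *m P (Fc p) = Z -> EL p Z = 0.
Proof.
move=> Bp ZP; have /(congr1 (fun w => bil (met g c (f p)) w Z)) := hharm ac Bp.
rewrite bil0l /horizontal_tension bilDl trace_betaHHE // !bil_suml -big_split /= => <-.
apply: eq_bigr => i _; rewrite [X in _ = _ + X]bilDl tensW_horz //; last by rewrite -cinvF.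
rewrite addr0 tensTstarP // tensTE //.
have Ez : cmap c (f p) = Fc p by [].
have gp : forall v : 'rV[R]_n, v != 0 -> 0 < bil (met g c (f p)) v v by exact: gram_pos.
have XP : dfHH F g f c p (e i) *m piH F g c (f p) = dfHH F g f c p (e i).
  by rewrite dfHHE // -[LHS]mulmxA -(cinvF Bp) -/(P _) (piH_idem F g ac) //; exact: BA.
have ZPf : Z *m piH F g c (f p) = Z by rewrite -(cinvF Bp).
rewrite XP ZPf.
have vv W : bil (met g c (f p)) (dfHV F g f c p (e i)) (W *m piV F g c (f p)) =
    bil (met g c (f p)) (dfHV F g f c p (e i)) W.
  rewrite -[in RHS](hvproj (vert F c (f p)) gp W) bilDr -[LHS]add0r; congr (_ + _).
  rewrite bil_sym; last exact: gram_sym.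
  by rewrite (horz_orth (V := vert F c (f p))) //; [exact: hproj_sub|exact: vproj_sub].
have T := tension_identity ac adapted hF ('D_(e i) (fun p => df f c p (e i)) p)
  (df f c p (e i)) (BA Bp) ZP.
rewrite /= (cinvF Bp) in T.
have hE : h (Fc p) = piH F g c (f p) *m met g c (f p) by rewrite /h /P /G cinvF.
have PE : P (Fc p) = piH F g c (f p) by rewrite /P cinvF.
have dE : dfHH F g f c p (e i) = df f c p (e i) *m piH F g c (f p) by [].
have dE' : dfHV F g f c p (e i) = df f c p (e i) *m piV F g c (f p) by [].
by rewrite vv hE PE dE dE' Ez; exact: (esym T).
Qed.

(** Each of the three terms vanishes because [h] has the vertical vectors in its
    kernel and is constant along them. *)
Let EL_vert p (U : 'rV[R]_n) : B p -> (U <= (copid_mx (codim F) : 'M[R]_n))%MS -> EL p U = 0.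
Proof.
move=> Bp UD; apply: big1 => i _; have Az := BA Bp.
have e1 (v w : 'rV[R]_n) : bil ('D_v h (Fc p)) w U = 0 by exact: (derive_trans_vertr g ac adapted).
have e2 : 'D_U h (Fc p) = 0 by exact: (derive_trans_vert0 ac adapted hF).
have e3 (w : 'rV[R]_n) : bil (h (Fc p)) w U = 0.
  by rewrite -bil_tr (trans_sym F g ac Az) bilMl (vert_piH g ac adapted Az UD) bil0l.
apply: etrans (scalars0 R); congr (_ + _ - _ * _); [exact: e3|exact: e1|].
by rewrite e2; exact: bil0m.
Qed.

Let EL_eq0 p Z : B p -> EL p Z = 0.
Proof.
move=> Bp; have Az := BA Bp.
have gp : forall v : 'rV[R]_n, v != 0 -> 0 < bil (met g c (f p)) v v by exact: gram_pos.
have E Z1 Z2 : EL p (Z1 + Z2) = EL p Z1 + EL p Z2.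
  rewrite /EL -big_split; apply: eq_bigr => i _ /=.
  have dh : 'D_(Z1 + Z2) h (Fc p) = 'D_Z1 h (Fc p) + 'D_Z2 h (Fc p).
    exact: (derive_trans_lin g ac adapted).
  apply: etrans (scalarsD _ _ _ _ _ _).
  by congr (_ + _ - _ * _); [exact: bilDr|exact: bilDr|rewrite dh; exact: bilDm].
rewrite -(hvproj (vert F c (f p)) gp Z) E EL_horz ?EL_vert ?addr0 //.
  by have := vproj_sub (met g c (f p)) (vert F c (f p)) Z; rewrite (adapted _).
by rewrite -[LHS]mulmxA /P cinvF // (hproj_idem _ gp).
Qed.

Let S i j p := bil (h (Fc p)) (df f c p (e i)) (df f c p (e j)).

Let derive_S i j v p : B p -> is_derive p v (S i j)
  (bil (h (Fc p)) ('D_v (fun p => df f c p (e i)) p) (df f c p (e j))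
   + bil ('D_(df f c p v) h (Fc p)) (df f c p (e i)) (df f c p (e j))
   + bil (h (Fc p)) (df f c p (e i)) ('D_v (fun p => df f c p (e j)) p)).
Proof.
move=> Bp.
have dhF := is_derive_comp_mx oA (trans_C1 g ac adapted) (BA Bp) (@dF p v Bp).
have dhFd : derivable (h \o Fc) p v by have [] := dhF.
have := derive_bil dhFd (@ddF i p v Bp) (@ddF j p v Bp).
by rewrite (derive_val (is_derive := dhF)).
Qed.

Let df_comm i j p : B p ->
  'D_(e i) (fun p => df f c p (e j)) p = 'D_(e j) (fun p => df f c p (e i)) p.
Proof.
move=> Bp; rewrite [LHS](derive_mx (@ddF j p (e i) Bp)) [RHS](derive_mx (@ddF i p (e j) Bp)).
apply/matrixP => a b; rewrite [LHS]mxE [RHS]mxE.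
have Fab := smooth_on_C1 oB smF a b.
have dE i' : forall p', B p' -> df f c p' (e i') a b = 'D_(e i') (fun p => Fc p a b) p'.
  by move=> p' Bp'; rewrite /df (derive_mx (@dF p' (e i') Bp')) mxE.
have near_dE i' j' : 'D_(e j') (fun p => df f c p (e i') a b) p =
    'D_(e j') ('D_(e i') (fun p => Fc p a b)) p.
  by apply: near_eq_derive; apply: filterS (open_near oB Bp) => p' Bp'; exact: dE.
have C i' : C1_on B ('D_(e i') (fun p => Fc p a b)).
  by apply: (C1_on_eq oB _ (smooth_on_C1 oB (smdF i') a b)) => p' Bp'; exact: dE.
rewrite [LHS]near_dE [RHS]near_dE.
exact: (schwarz oB Fab (C j) (C i) Bp).
Qed.

(** This is the Euler-Lagrange equation at [Z = df(e_j)]: as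
    [D_i df(e_j) = D_j df(e_i)], the second derivatives of [f] combine into
    derivatives of [S]. *)
Lemma chart_conservation j p : B p ->
  \sum_i 'D_(e i) (S i j) p = 2^-1 * \sum_i 'D_(e j) (S i i) p.
Proof.
move=> Bp; have := EL_eq0 (df f c p (e j)) Bp.
move=> E; rewrite mulr_sumr; apply/eqP; rewrite -subr_eq0 -sumrB; apply/eqP.
apply: etrans E; apply: eq_bigr => i _.
have d1 := derive_val (is_derive := derive_S i j (e i) Bp).
have d2 := derive_val (is_derive := derive_S i i (e j) Bp).
apply: (etrans (congr2 (fun a b => a - 2^-1 * b) d1 d2)).
have hs u w : bil (h (Fc p)) u w = bil (h (Fc p)) w u.
  by rewrite -[LHS]bil_tr (trans_sym F g ac (BA Bp)).
apply: conservation_scalars; last exact: (hs ('D_(e j) _ p) (df f c p (e i))).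
exact: (congr1 (bil (h (Fc p)) (df f c p (e i))) (df_comm _ _ Bp)).
Qed.

Lemma chart_C1 i j : C1_on B (S i j).
Proof.
have CF := smooth_on_C1 oB smF.
have ChF : C1_mx_on B (h \o Fc).
  move=> a b.
  exact: (C1_on_comp oB oA (smooth_on_continuous smF) BA (trans_C1 g ac adapted a b) CF).
have := C1_mx_onM oB (C1_mx_onM oB (smooth_on_C1 oB (smdF i)) ChF)
  (C1_mx_on_tr oB (smooth_on_C1 oB (smdF j))).
exact.
Qed.

End in_adapted_chart.
End harmonic_map.

(** * Independence of the chart, and the pulled-back transverse metric *)

Section vector_differentiable.
Variables (R : realType) (n l : nat).

Lemma C1_mx_differentiable (A : set 'rV[R]_n) (T : 'rV[R]_n -> 'rV[R]_l) z :
  open A -> C1_mx_on A T -> A z -> differentiable T z.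
Proof.
move=> oA CT Az.
have -> : T = \sum_(j < l) (fun x => T x ord0 j *: (delta_mx ord0 j : 'rV[R]_l)).
  by apply/funext => x; rewrite fct_sumE [LHS]row_sum_delta.
apply: differentiable_sum => j; apply: differentiableZl.
exact: C1_differentiable oA (CT ord0 j) Az.
Qed.

End vector_differentiable.

Section chart_change.
Variables (R : realType) (m k n : nat) (N : manifold R n).
Variables (F : foliation N) (g : metric N) (f : 'rV[R]_m * 'rV[R]_k -> N).
Hypothesis hf : smooth_map f.
Variables c c' : chart R n N.
Hypotheses (ac : atlas c) (ac' : atlas c').

Let A := cmap c @` (cdom c `&` cdom c').

Lemma open_overlap : open A.
Proof.
rewrite openE => _ [q [cq cq'] <-]; rewrite /interior.
have Iz : (cmap c @` cdom c) (cmap c q) by exists q.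
have n1 : \forall z \near cmap c q, (cmap c @` cdom c) z.
  exact: open_near (@cimg_open _ _ _ c) Iz.
have n2 : \forall z \near cmap c q, cdom c' (cinv c z).
  have := cinv_continuous Iz; rewrite /prop_for /continuous_at cmapK // => cv.
  by apply: cv; apply: open_near (@cdom_open _ _ _ c') cq'.
apply: filterS2 n1 n2 => z [q' cq1 <-]; rewrite cmapK // => cq2.
by exists q'.
Qed.

Lemma df_change p v : cdom c (f p) -> cdom c' (f p) ->
  df f c' p v = df f c p v *m chart_jac c c' (f p).
Proof.
move=> cp cp'; have Az : A (cmap c (f p)) by exists (f p).
have CT : C1_mx_on A (transition c c').
  by apply: smooth_on_C1; [exact: open_overlap|exact: atlas_smooth].
have oB : open (f @^-1` cdom c).
  by move: (hf.1) => /continuousP; apply; exact: cdom_open.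
have dF : derivable (cmap c \o f) p v.
  exact: C1_mx_derivable (smooth_on_C1 oB (hf.2 c ac)) cp.
have dT := C1_mx_differentiable open_overlap CT Az.
have D := is_derive_comp_mx open_overlap CT Az dF.
apply: etrans (deriveEjacobian _ dT); apply: etrans (derive_val (is_derive := D)).
apply: near_eq_derive; apply: filterS (open_near oB cp) => p' cp1.
by rewrite /transition /= cmapK.
Qed.

Lemma inner_dfHH_change p u w : cdom c (f p) -> cdom c' (f p) ->
  inner g c (f p) (dfHH F g f c p u) (dfHH F g f c p w) =
  inner g c' (f p) (dfHH F g f c' p u) (dfHH F g f c' p w).
Proof.
move=> cp cp'.
have E v : dfHH F g f c' p v = df f c p (projH v) *m chart_jac c c' (f p) *m piH F g c' (f p).
  by rewrite /dfHH (df_change (projH v) cp cp').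
rewrite [dfHH F g f c' p u]E [dfHH F g f c' p w]E.
apply: (bil_hproj_change (J := chart_jac c c' (f p))).
- exact: gram_pos.
- exact: gram_pos.
- exact: met_change.
- exact: vert_change.
Qed.

End chart_change.

Section transverse_tensor.
Variables (R : realType) (m k n : nat) (N : manifold R n).
Variables (F : foliation N) (g : metric N) (f : 'rV[R]_m * 'rV[R]_k -> N).
Hypotheses (hF : riemannian_foliation F g) (hf : smooth_map f)
  (hharm : horizontally_harmonic F g f).

Let M := ('rV[R]_m * 'rV[R]_k)%type.
Local Notation e i := (frameH R k i).

(** The matrix of the pull-back by [f] of the transverse metric.  The chart at
    each point is immaterial ([pullback_trans_chart]), so that local properties
    can be read in charts adapted to the foliation. *)
Definition pullback_trans (i j : 'I_m) (p : M) : R :=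
  let c := chart_at (f p) in
  inner g c (f p) (dfHH F g f c p (e i)) (dfHH F g f c p (e j)).

Lemma pullback_trans_psd p (a : 'I_m -> R) :
  0 <= \sum_i \sum_j a i * a j * pullback_trans i j p.
Proof.
rewrite /pullback_trans; set c := chart_at (f p).
have cp : cdom c (f p) by exact: chart_at_dom.
have ac : atlas c by exact: atlas_chart_at.
pose X := \sum_i a i *: dfHH F g f c p (e i).
have -> : \sum_i \sum_j a i * a j *
    inner g c (f p) (dfHH F g f c p (e i)) (dfHH F g f c p (e j)) = bil (met g c (f p)) X X.
  rewrite /X bil_suml; apply: eq_bigr => i _.
  rewrite bilZl bil_sumr mulr_sumr; apply: eq_bigr => j _.
  by rewrite bilZr mulrA.
have [->|X0] := eqVneq X 0; first by rewrite bil0l.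
exact/ltW/met_pos.
Qed.

Lemma pullback_trans_chart i j c p : atlas c -> cdom c (f p) ->
  pullback_trans i j p =
    bil (piH F g c (cinv c (cmap c (f p))) *m met g c (cinv c (cmap c (f p))))
      (df f c p (e i)) (df f c p (e j)).
Proof.
move=> ac cp; rewrite /pullback_trans.
rewrite (inner_dfHH_change F g hf (atlas_chart_at _) ac _ _ (chart_at_dom _) cp).
rewrite cmapK // /dfHH -(gram_hproj _ (gram_pos g ac cp)).
by rewrite -piHE bilMr !bilMl.
Qed.

Let near_chart p : exists c, [/\ atlas c, cdom c (f p),
  forall q, cdom c q -> (vert F c q :=: copid_mx (codim F))%MS & 
  open (f @^-1` cdom c)].
Proof.
have [c [ac cp ad]] := vert_integrable F (f p); exists c; split => //.
by move: (hf.1) => /continuousP; apply; exact: cdom_open.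
Qed.

Lemma pullback_trans_C1 i j : C1_on setT (pullback_trans i j).
Proof.
move=> p _; have [c [ac cp ad oB]] := near_chart p.
have C := chart_C1 g hf ac ad i j.
have E p' : (f @^-1` cdom c) p' -> _ = pullback_trans i j p' :=
  fun cp' => esym (pullback_trans_chart i j ac cp').
exact: (C1_on_eq oB E C) cp.
Qed.

(** The law is local in the source, hence may be checked in an adapted chart
    around [f p]. *)
Lemma pullback_trans_conservation j p :
  \sum_i 'D_(e i) (pullback_trans i j) p =
  2^-1 * \sum_i 'D_(e j) (pullback_trans i i) p.
Proof.
have [c [ac cp ad oB]] := near_chart p.
have nE a b v : 'D_v (pullback_trans a b) p = 'D_v (fun p => bil
    (piH F g c (cinv c (cmap c (f p))) *m met g c (cinv c (cmap c (f p))))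
      (df f c p (e a)) (df f c p (e b))) p.
  apply: near_eq_derive; apply: filterS (open_near oB cp) => p' cp'.
  exact: pullback_trans_chart.
have H := chart_conservation hF hf hharm ac ad j cp.
apply: (etrans (eq_bigr _ (fun i _ => nE i j (e i)))); apply: (etrans H).
by congr (_ * _); apply: eq_bigr => i _; apply: esym; exact: nE.
Qed.

End transverse_tensor.

(** * Integration of compactly supported functions *)

Section borel.
Variables (R : realType) (n : nat).

(* Lattice cells of mesh [1 / j.+1]. *)
Let corner (jz : nat * 'rV[int]_n) (s : R) : 'rV[R]_n :=
  \row_i (((jz.2 ord0 i)%:~R + s) / jz.1.+1%:R).
Let cell (jz : nat * 'rV[int]_n) := box (corner jz 0) (corner jz 1).

(** An open set is the countable union of the lattice cells that it contains. *)
Lemma open_measurable_row (A : set 'rV[R]_n) : open A -> measurable A.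
Proof.
move=> oA; pose F jz := if `[< cell jz `<=` A >] then cell jz else set0.
suff -> : A = \bigcup_jz F jz.
  apply: countable_bigcupT_measurable; first exact: countableP.
  by move=> jz; rewrite /F; case: ifP => _ //; exact: measurable_box.
apply/seteqP; split => [x Ax|x [jz _]]; last first.
  by rewrite /F; case: asboolP => // sub /sub.
have /nbhs_ballP[r /= r0 rA] : nbhs x A by exact: open_near oA Ax.
pose j := Num.bound r^-1.
have jr : j.+1%:R^-1 < r.
  rewrite invf_plt ?posrE ?ltr0n //; apply: lt_le_trans (archi_boundP _) _.
    by rewrite invr_ge0 ltW.
  by rewrite ler_nat.
have j0 : 0 < j.+1%:R :> R by rewrite ltr0n.
pose z : 'rV[int]_n := \row_i (Num.ceil (x ord0 i * j.+1%:R) - 1).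
have xz : cell (j, z) x.
  move=> i; rewrite !mxE /= addr0 ltr_pdivrMr // ler_pdivlMr //.
  have /andP[h1 h2] := ceil_itv (x ord0 i * j.+1%:R).
  by rewrite h1 /= (le_trans h2) // intrD -addrA addNr addr0.
exists (j, z) => //; rewrite /F; case: asboolP => // -[] y yz; apply: rA.
rewrite -ball_normE /= [ltLHS]/Num.Def.normr/= mx_normrE.
apply: bigmax_lt => // -[i i'] _ /=; rewrite (ord1 i : i = ord0) !mxE; apply: le_lt_trans jr.
have := xz i'; have := yz i'; rewrite !mxE /= addr0.
set t := _%:~R / _; rewrite mulrDl mul1r -/t => /andP[y1 y2] /andP[x1 x2].
rewrite ler_distl lerBlDr; apply/andP; split.
  by apply: le_trans y2 _; rewrite lerD2r ltW.
by apply: le_trans x2 _; rewrite lerD2r ltW.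
Qed.

Lemma continuous_measurable_row (u : 'rV[R]_n -> R) : continuous u ->
  measurable_fun setT (u : _ -> measurableTypeR R).
Proof.
move=> cu; apply: (measurability _ (RGenOpens.measurableE R)) => // _ [_ [a [b ->] <-]].
rewrite setTI; apply: open_measurable_row.
by apply: open_comp; [move=> x _; exact: cu|exact: interval_open].
Qed.

End borel.

Section bounded_support.
Local Open Scope ereal_scope.
Context d (T : measurableType d) (R : realType) (mu : {measure set T -> \bar R}).

Lemma bounded_support_integrable (f : T -> R) (A : set T) (C : R) :
  measurable A -> mu A < +oo -> measurable_fun setT f ->
  (forall x, `|f x| <= C)%R -> (forall x, ~ A x -> f x = 0%R) ->
  mu.-integrable setT (EFin \o f).
Proof.
move=> mA Afin mf fC fA.
have : mu.-integrable A (EFin \o f).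
  apply: measurable_bounded_integrable => //; first exact: measurable_funTS.
  exists C; split; first exact: num_real.
  by move=> M CM x _; exact: le_trans (fC x) (ltW CM).
move/(integrable_mkcond _ mA); congr (mu.-integrable setT _).
apply/funext => x; rewrite patchE; case: ifPn => // /negP xA /=.
by rewrite fA // => Ax; apply: xA; rewrite inE.
Qed.

End bounded_support.

Section compact_support.
Variables (R : realType) (n : nat).
Implicit Types (u : 'rV[R]_n -> R) (K : R).

Definition supported u K := forall x : 'rV[R]_n, (exists j, K < `|x ord0 j|) -> u x = 0.

Lemma cube_bounded u K : 0 < K -> continuous u ->
  exists C, forall x : 'rV[R]_n, (forall j, `|x ord0 j| <= K) -> `|u x| <= C.
Proof.
move=> K0 cu.
pose A := [set x : 'rV[R]_n | forall i, x ord0 i \in `[- K, K]].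
have cA : compact A.
  by apply: (@rV_compact _  _ (fun=> `[- K, K]%classic)) => _; exact: segment_compact.
have A0 : A !=set0 by exists 0 => i; rewrite mxE in_itv /= oppr_le0 ltW //= ltW.
have [|x0 _ x0max] := compact_EVT_max A0 cA (f := fun x => `|u x|).
  apply: continuous_subspaceT => x.
  by apply: continuous_comp (cu x) _; exact: norm_continuous.
exists `|u x0| => x xK; apply: x0max; rewrite inE => i.
by rewrite in_itv /= -ler_norml.
Qed.

Lemma supported_bounded u K : 0 < K -> continuous u -> supported u K ->
  exists C, forall x, `|u x| <= C.
Proof.
move=> K0 cu su; have [C uC] := cube_bounded K0 cu.
exists C => x; have [xK|/existsNP[j /negP xj]] := pselect (forall j, `|x ord0 j| <= K).
  exact: uC.
rewrite su; last by exists j; rewrite ltNge.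
by rewrite normr0; apply: le_trans (uC 0 _) => // i; rewrite mxE normr0 ltW.
Qed.

(* Boxes omit their lower faces, whence the margin [1] around the cube. *)
Let bigbox K : set 'rV[R]_n := box (const_mx (- (K + 1))) (const_mx (K + 1)).

Lemma bigbox_finite K : 0 < K -> (lebesgue_row R n (bigbox K) < +oo)%E.
Proof.
move=> K0; rewrite lebesgue_row_box ?ltry // => i; rewrite !mxE.
by apply: (@le_trans _ _ 0); [rewrite oppr_le0|]; rewrite addr_ge0 // ltW.
Qed.

Lemma bigbox_out u K x : supported u K -> ~ bigbox K x -> u x = 0.
Proof.
move=> su nx; apply: su; apply: contra_notP nx => h i; rewrite !mxE.
have : `|x ord0 i| <= K by rewrite leNgt; apply/negP => Ki; apply: h; exists i.
by rewrite ler_norml => /andP[h1 h2]; apply/andP; split; lra.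
Qed.

Lemma supported_integrable u K : 0 < K -> continuous u -> supported u K ->
  (lebesgue_row R n).-integrable setT (EFin \o u).
Proof.
move=> K0 cu su; have [C uC] := supported_bounded K0 cu su.
apply: (bounded_support_integrable (A := bigbox K) (C := C)) => //.
- exact: measurable_box.
- exact: bigbox_finite.
- exact: continuous_measurable_row.
- by move=> x; exact: bigbox_out.
Qed.

Lemma bounded_set_integrable u (B : set 'rV[R]_n) K : 0 < K -> continuous u ->
  measurable B -> (forall x, B x -> forall j, `|x ord0 j| <= K) ->
  (lebesgue_row R n).-integrable B (EFin \o u).
Proof.
move=> K0 cu mB BK; have mA : measurable (bigbox K) by exact: measurable_box.
apply: (@integrableS _ _ _ _ (bigbox K)) => //.
  move=> x /BK xK i; rewrite !mxE; have := xK i; rewrite ler_norml => /andP[h1 h2].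
  by apply/andP; split; lra.
apply: measurable_bounded_integrable => //; first exact: bigbox_finite.
  by apply: measurable_funTS; exact: continuous_measurable_row.
have [|C uC] := @cube_bounded u (K + 1) _ cu; first by rewrite addr_gt0.
exists C; split; first exact: num_real.
move=> M CM x xb; apply: le_trans (uC x _) (ltW CM) => i.
by have := xb i; rewrite !mxE ler_norml => /andP[/ltW -> ->].
Qed.

(** The complement of the closed cube is open, so the function is locally zero
    there. *)
Lemma supported_derive u K v : supported u K -> supported ('D_v u) K.
Proof.
move=> su x [j xj]; rewrite -(derive_cst (0 : R) x v); apply: near_eq_derive.
have : nbhs x [set y : 'rV[R]_n | K < `|y ord0 j|].
  have c : continuous (fun y : 'rV[R]_n => `|y ord0 j|).
    move=> y; apply: (@continuous_comp _ _ _ (fun y : 'rV[R]_n => y ord0 j) (fun t : R => `|t|)).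
      exact: continuous_coord.
    exact: norm_continuous.
  apply: (@open_near _ [set y : 'rV[R]_n | K < `|y ord0 j|] x _ xj).
  exact: (@open_comp _ _ (fun y : 'rV[R]_n => `|y ord0 j|) [set t | K < t] (fun y _ => c y) (@open_gt _ K)).
by apply: filterS => y yj; apply: su; exists j.
Qed.

End compact_support.

Section integral_line.
Variable R : realType.

Lemma integral_derive_line (w w' : R -> R) (K : R) : 0 < K ->
  (forall t : R, is_derive t 1 w (w' t)) -> continuous w' ->
  (forall t, K < `|t| -> w t = 0) -> (forall t, K < `|t| -> w' t = 0) ->
  (\int[lebesgue_measure]_t (w' t)%:E = 0)%E.
Proof.
move=> K0 dw cw sw sw'; pose b := K + 1.
have b0 : - b < b by rewrite /b; lra.
have big (t : R) : (t \in `[- b, b]) = false -> K < `|t|.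
  move=> h; rewrite ltNge; apply/negP => tK; move: h; rewrite in_itv /= -ler_norml.
  by rewrite (le_trans tK) // /b lerDl.
have -> : (\int[lebesgue_measure]_t (w' t)%:E = \int[lebesgue_measure]_(t in `[(- b)%R, b%R]) (w' t)%:E)%E.
  rewrite [RHS]integral_mkcond; apply: eq_integral => t _.
  rewrite patchE; case: ifPn => //; rewrite notin_setE => nt.
  by rewrite sw' //; apply: big; apply/negP => h; apply: nt.
have dw1 (t : R) : derivable w t 1 by have [] := dw t.
have cw0 : continuous w.
  by move=> t; apply/differentiable_continuous/derivable1_diffP.
rewrite (continuous_FTC2 b0 (F := w)).
- have kb : K < `|b| by rewrite /b gtr0_norm; lra.
  by rewrite !sw ?normrN // sub0e oppe0.
- exact: continuous_subspaceT.
- split; first by move=> t _; exact: dw1.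
  + exact/cvg_at_right_filter/cw0.
  + exact/cvg_at_left_filter/cw0.
- by move=> t _; rewrite derive1E; have [] := dw t.
Qed.

End integral_line.

(** * The divergence theorem, one coordinate at a time *)

Section integral_partial.
Variable R : realType.

Lemma integrable_consr n (v : 'rV[R]_n.+1 -> R) K : 0 < K -> continuous v -> supported v K ->
  (lebesgue_measure \x lebesgue_row R n)%E.-integrable setT (EFin \o (v \o @consr R n)).
Proof.
move=> K0 cv sv; have [C vC] := supported_bounded K0 cv sv.
pose A : set 'rV[R]_n.+1 := box (const_mx (- (K + 1))) (const_mx (K + 1)).
have mA : measurable A by exact: measurable_box.
apply: (bounded_support_integrable (A := @consr R n @^-1` A) (C := C)) => //.
- by rewrite -[X in measurable X]setTI; exact: measurable_consr.
- exact: (bigbox_finite n.+1 K0).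
- apply: measurableT_comp; last exact: measurable_consr.
  exact: continuous_measurable_row.
- by move=> p; exact: vC.
- by move=> p np; exact: (bigbox_out sv np).
Qed.

Lemma integral_row_succ n (v : 'rV[R]_n.+1 -> R) K : 0 < K -> continuous v -> supported v K ->
  (\int[lebesgue_row R n.+1]_x (v x)%:E =
   \int[lebesgue_measure \x lebesgue_row R n]_p (v (consr p))%:E)%E.
Proof.
move=> K0 cv sv.
apply: etrans (@integral_pushforward _ _ _ _ R (@consr R n) (@measurable_consr R n)
  (lebesgue_measure \x lebesgue_row R n)%E setT (EFin \o v) _ _ _) => //.
- by apply/measurable_EFinP; exact: continuous_measurable_row.
- by rewrite preimage_setT; exact: integrable_consr cv sv.
Qed.

Lemma consr_head n (t : R) (x : 'rV[R]_n) :
  consr (t, x) = t *: delta_mx ord0 ord0 + consr (0, x).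
Proof.
apply/rowP => i; rewrite [RHS]mxE [X in _ = X + _]mxE [X in _ = _ * X + _]mxE eqxx /=.
case: (unliftP ord0 i) => [j|] ->.
  by rewrite !consrS /= mulr0 add0r.
by rewrite !consr0 /= mulr1 addr0.
Qed.

Lemma consr_tail n (t h : R) j (x : 'rV[R]_n) :
  consr (t, h *: delta_mx ord0 j + x) = h *: delta_mx ord0 (lift ord0 j) + consr (t, x).
Proof.
apply/rowP => i; rewrite [RHS]mxE [X in _ = X + _]mxE [X in _ = _ * X + _]mxE eqxx /=.
case: (unliftP ord0 i) => [l|] ->.
  by rewrite !consrS /= !mxE eqxx /= (inj_eq lift_inj).
by rewrite !consr0 /= mulr0 add0r.
Qed.

(** Gives the continuity of coordinate insertions and projections for the sup norm. *)
Lemma nonexpansive_continuous (U V : normedModType R) (F : U -> V) :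
  (forall x y, `|F x - F y| <= `|x - y|) -> continuous F.
Proof.
move=> ne x; apply/cvgrPdist_le => e e0; near=> y.
apply: (le_trans (ne x y)); near: y.
by have /cvgrPdist_le/(_ _ e0) := @cvg_id _ (nbhs x).
Unshelve. all: by end_near. Qed.

Lemma continuous_consr_row n (t : R) : continuous (fun x : 'rV[R]_n => consr (t, x)).
Proof.
apply: nonexpansive_continuous => x y.
rewrite [leLHS]/Num.Def.normr/= mx_normrE bigmax_le // => -[i l] _ /=.
rewrite (ord1 i : i = ord0) [X in `|X|]mxE [X in `|_ + X|]mxE; case: (unliftP ord0 l) => [j|] ->.
  rewrite !consrS /= [leRHS]/Num.Def.normr/= mx_normrE.
  by apply: le_trans (le_bigmax _ _ (ord0, j)); rewrite !mxE.
by rewrite !consr0 subrr normr0.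
Qed.

(** Integrating one coordinate at a time, a partial derivative of a compactly
    supported function has integral zero. *)
Lemma integral_partial_eq0 n (i : 'I_n) (u : 'rV[R]_n -> R) K : 0 < K ->
  (forall x, derivable u x (delta_mx ord0 i)) ->
  continuous ('D_(delta_mx ord0 i) u) -> supported u K ->
  (\int[lebesgue_row R n]_x ('D_(delta_mx ord0 i) u x)%:E = 0)%E.
Proof.
move=> K0; elim: n i u => [[]//|n ih] i u du cu su.
have sv := supported_derive (delta_mx ord0 i) su.
have int := integrable_consr K0 cu sv.
rewrite (integral_row_succ K0 cu sv).
have [j ij|i0] := unliftP ord0 i.
  rewrite -(integral12_prod_meas1 int); apply: integral0_eq => t _.
  rewrite /fubini_F /=; pose ut (x : 'rV[R]_n) := u (consr (t, x)).
  have line x : (fun h : R => h^-1 *: (ut (h *: delta_mx ord0 j + x) - ut x)) =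
      (fun h : R => h^-1 *: (u (h *: delta_mx ord0 i + consr (t, x)) - u (consr (t, x)))).
    by apply/funext => h; rewrite /ut consr_tail ij.
  have D x : 'D_(delta_mx ord0 i) u (consr (t, x)) = 'D_(delta_mx ord0 j) ut x.
    by rewrite /derive line.
  under eq_integral do rewrite D.
  apply: ih.
  - by move=> x; rewrite /derivable line; exact: du.
  - rewrite (_ : 'D_(delta_mx ord0 j) ut = fun x => 'D_(delta_mx ord0 i) u (consr (t, x))).
      move=> x; apply: (@continuous_comp _ _ _ (fun x : 'rV[R]_n => consr (t, x))
        ('D_(delta_mx ord0 i) u)); first exact: continuous_consr_row.
      exact: cu.
    by apply/funext => x; rewrite D.
  - by move=> x [l xl]; apply: su; exists (lift ord0 l); rewrite consrS.
subst i; rewrite -(integral21_prod_meas1 int); apply: integral0_eq => x _.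
rewrite /fubini_G /=.
pose line (t : R) := t *: delta_mx ord0 ord0 + consr (0, x).
have cline : continuous line.
  move=> t; apply: cvgD; last exact: cvg_cst.
  by apply: cvgZr_tmp; exact: cvg_id.
under eq_integral do rewrite consr_head.
apply: (integral_derive_line (w := u \o line) K0).
- by move=> t; apply: is_derive_line; exact: du.
- move=> t; apply: (@continuous_comp _ _ _ line ('D_(delta_mx ord0 ord0) u)).
    exact: cline.
  exact: cu.
- by move=> t Kt; apply: su; exists ord0; rewrite /line -consr_head consr0.
- by move=> t Kt; apply: sv; exists ord0; rewrite /line -consr_head consr0.
Qed.

End integral_partial.

(** * Smoothed cut-off profiles *)

Section cutoff.
Variable R : realType.
Implicit Types (s t eps p r : R).

Let pp t := Num.max t 0.

Let pp_ge0 t : 0 <= pp t. Proof. by rewrite le_max lexx orbT. Qed.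
Let ge_pp t : t <= pp t. Proof. by rewrite le_max lexx. Qed.
Let pp_le0 t : t <= 0 -> pp t = 0. Proof. by move=> t0; exact/max_idPr. Qed.
Let pp_gt0 t : 0 <= t -> pp t = t. Proof. by move=> t0; exact/max_idPl. Qed.

Let continuous_pp : continuous pp.
Proof. by move=> t; apply: continuous_max => //; exact: cvg_cst. Qed.

(** Squaring makes the positive part C1: the difference quotient at [0] is [h] or
    [0]. *)
Let is_derive_sqr_pp t : is_derive t 1 (fun t => pp t ^+ 2) (2 * pp t).
Proof.
have [t0|t0|->] := ltgtP t 0.
- rewrite pp_le0 ?ltW // mulr0.
  have d : is_derive t 1 (cst 0 : R -> R) 0 by exact: is_derive_cst.
  apply: near_eq_is_derive d.
  by near=> u; rewrite pp_le0 ?expr0n //; apply: ltW; near: u; exact: (open_near (@open_lt _ 0) t0).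
- rewrite pp_gt0 ?ltW //.
  have d : is_derive t 1 (fun u : R => u ^+ 2) (2 * t).
    by apply: (is_derive_eq (is_deriveX 2 (is_derive_id t 1))); rewrite expr1 /GRing.scale /= mulr1 mulr_natl.
  apply: near_eq_is_derive d.
  by near=> u; rewrite pp_gt0 //; apply: ltW; near: u; exact: (open_near (@open_gt _ 0) t0).
- rewrite pp_le0 // mulr0.
  have c : h^-1 *: (pp (h *: 1 + 0) ^+ 2 - pp 0 ^+ 2) @[h --> (0 : R)^'] --> (0 : R).
    apply/cvgr0Pnorm_le => e e0; near=> h.
    have h0 : h != 0 by near: h; exact: nbhs_dnbhs_neq.
    rewrite (@pp_le0 0) // expr0n /= subr0 addr0 [h *: 1]mulr1.
    have [h1|h1] := leP h 0; first by rewrite pp_le0 // expr0n /= scaler0 normr0 ltW.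
    rewrite pp_gt0 ?ltW // expr2 [_ *: _]mulKf //.
    by near: h; exact: dnbhs0_lt.
  split; first by apply/cvg_ex; exists 0.
  exact: cvg_lim c.
Unshelve. all: by end_near. Qed.

(** A C1 approximation from below of the positive part. *)
Let q eps t := Num.sqrt (pp t ^+ 2 + eps ^+ 2) - eps.
Let q' eps t := pp t / Num.sqrt (pp t ^+ 2 + eps ^+ 2).

Section approx.
Variable eps : R.
Hypothesis eps0 : 0 < eps.

Let rad_gt0 t : 0 < pp t ^+ 2 + eps ^+ 2.
Proof. by rewrite ltr_wpDl ?sqr_ge0 ?exprn_gt0. Qed.

Let is_derive_q t : is_derive t 1 (q eps) (q' eps t).
Proof.
have d1 := is_deriveD (is_derive_sqr_pp t) (is_derive_cst (eps ^+ 2) t 1).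
have d2 := is_derive1_sqrt (rad_gt0 t).
have d3 := is_derive1_comp (f := Num.sqrt) (g := (fun t => pp t ^+ 2) + cst (eps ^+ 2)) d2 d1.
have d4 := is_deriveB d3 (is_derive_cst eps t 1).
apply: is_derive_eq d4 _.
by rewrite subr0 addr0 /q' invfM mulrACA mulVf ?pnatr_eq0 // mul1r mulrC.
Qed.

Let continuous_q' : continuous (q' eps).
Proof.
move=> t; apply: cvgM; first exact: continuous_pp.
apply: cvgV; first by rewrite gt_eqF // sqrtr_gt0.
apply: (@continuous_comp _ _ _ (fun t => pp t ^+ 2 + eps ^+ 2) Num.sqrt); last exact: sqrt_continuous.
apply: cvgD; last exact: cvg_cst.
by apply: cvgM; exact: continuous_pp.
Qed.

Let q'_ge0 t : 0 <= q' eps t.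
Proof. by rewrite divr_ge0 // sqrtr_ge0. Qed.

Let q'_le1 t : q' eps t <= 1.
Proof.
rewrite ler_pdivrMr ?sqrtr_gt0 // mul1r -[leLHS]ger0_norm // -sqrtr_sqr.
by rewrite ler_wsqrtr // lerDl sqr_ge0.
Qed.

Let q_le0 t : t <= 0 -> q eps t = 0.
Proof.
by move=> t0; rewrite /q pp_le0 // expr0n /= add0r sqrtr_sqr gtr0_norm // subrr.
Qed.

Let q'_le0 t : t <= 0 -> q' eps t = 0.
Proof. by move=> t0; rewrite /q' pp_le0 // mul0r. Qed.

Let q_ge t : t - eps <= q eps t.
Proof.
rewrite lerD2r; apply: (le_trans (ge_pp t)).
by rewrite -[leLHS]ger0_norm // -sqrtr_sqr ler_wsqrtr // lerDl sqr_ge0.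
Qed.

Let q_homo t u : t <= u -> q eps t <= q eps u.
Proof.
move=> tu; rewrite lerD2r ler_wsqrtr // lerD2r lerXn2r ?nnegrE //.
by rewrite /pp ge_max !le_max tu lexx orbT.
Qed.

Let q_ge0 t : 0 <= q eps t.
Proof.
have [t0|t0] := leP t 0; first by rewrite q_le0.
by rewrite -(@q_le0 0) //; apply: q_homo; exact: ltW.
Qed.

(** The real power [r ^ (- p)], for [r > 0]. *)
Definition rpow (p r : R) := expR (- p * ln r).

Lemma rpow_gt0 p r : 0 < rpow p r. Proof. exact: expR_gt0. Qed.

Lemma rpow_le p (r1 r2 : R) : 0 < p -> 0 < r1 -> r1 <= r2 -> rpow p r2 <= rpow p r1.
Proof.
move=> p0 r10 r12; rewrite ler_expR !mulNr lerN2 ler_pM2l //.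
by rewrite ler_ln ?posrE // (lt_le_trans r10).
Qed.

Lemma is_derive_rpow p r : 0 < r -> is_derive r 1 (rpow p) (- p * rpow p r / r).
Proof.
move=> r0.
have d1 := is_derive1_ln r0.
have d2 : is_derive r 1 (fun r => - p * ln r) (- p / r).
  apply: (is_derive_eq (is_deriveM (is_derive_cst (- p) r 1) d1)).
  by rewrite /GRing.scale /= mulr0 addr0.
apply: (is_derive_eq (is_derive1_comp (is_derive_expR _) d2)).
by rewrite /rpow; ring.
Qed.

(** A C1 version of the Lipschitz profile
    [s |-> (max(s, r1) ^ (- p) - r2 ^ (- p))_+ / p], for which the combination
    [- p eta - s eta'] is the jump function
    [r2 ^ (- p) 1_(s <= r2) - r1 ^ (- p) 1_(s <= r1)]; the smoothing only costs [eps]. *)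
Lemma cutoff_profile p (r1 r2 : R) : 0 < p -> 0 < r1 -> r1 < r2 ->
  exists eta eta' : R -> R, [/\ forall s, is_derive s 1 eta (eta' s), continuous eta',
    forall s, eta' s <= 0, forall s, r2 <= s -> eta s = 0 &
    forall s, 0 <= s -> - p * eta s - s * eta' s <=
      (rpow p r2 + eps) * (s <= r2)%R%:R - rpow p (r1 + eps) * (s <= r1)%R%:R].
Proof.
move=> p0 r10 r12.
(* [M] smooths [max(s, r1) + eps] and is constant on the small ball; *)
(* [q eps (t s)] smooths the positive part of [t s].                 *)
pose M s := r1 + eps + q eps (s - r1); pose M' s := q' eps (s - r1).
have M_ge s : s <= M s.
  by have := q_ge (s - r1); rewrite /M; lra.
have M_gt0 s : 0 < M s by rewrite /M ltr_pwDl // addr_gt0.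
have dM s : is_derive s 1 M (M' s).
  have d1 := is_deriveB (is_derive_id s 1) (is_derive_cst r1 s 1).
  have d2 := is_derive1_comp (f := q eps) (g := id - cst r1) (is_derive_q _) d1.
  have d3 := is_deriveD (is_derive_cst (r1 + eps) s 1) d2.
  by apply: (is_derive_eq d3); rewrite subr0 mulr1 add0r.
have cM : continuous M.
  by move=> s; apply/differentiable_continuous/derivable1_diffP; have [] := dM s.
have cM' : continuous M'.
  move=> s; apply: (@continuous_comp _ _ _ (fun s => s - r1) (q' eps)); last exact: continuous_q'.
  by apply: cvgB; [exact: cvg_id|exact: cvg_cst].
pose A s := rpow p (M s).
have dA s : is_derive s 1 A (- p * A s / M s * M' s).
  exact: (is_derive1_comp (is_derive_rpow p (M_gt0 s)) (dM s)).
have cA : continuous A.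
  by move=> s; apply/differentiable_continuous/derivable1_diffP; have [] := dA s.
pose t s := A s - A r2.
have dt s : is_derive s 1 t (- p * A s / M s * M' s).
  have d := is_deriveB (dA s) (is_derive_cst (A r2) s 1).
  by apply: (is_derive_eq d); rewrite subr0.
have ct : continuous t.
  by move=> s; apply/differentiable_continuous/derivable1_diffP; have [] := dt s.
have t_le0 s : r2 <= s -> t s <= 0.
  move=> rs; rewrite subr_le0 rpow_le // lerD2l q_homo // lerD2r //.
have Ar2 : A r2 <= rpow p r2 by rewrite rpow_le // (lt_trans r10).
exists (fun s => p^-1 * q eps (t s)), (fun s => - (q' eps (t s) * A s / M s * M' s)).
split.
- move=> s; have d1 := is_derive1_comp (f := q eps) (g := t) (is_derive_q _) (dt s).
  have d2 := is_deriveM (is_derive_cst p^-1 s 1) d1.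
  apply: (is_derive_eq d2); rewrite /GRing.scale /= mulr0 addr0; field.
  by rewrite !gt_eqF.
- move=> s; apply: cvgN; apply: cvgM; last exact: cM'.
  apply: cvgM; last by apply: cvgV; [rewrite gt_eqF|exact: cM].
  apply: cvgM; last exact: cA.
  by apply: (@continuous_comp _ _ _ t (q' eps)); [exact: ct|exact: continuous_q'].
- by move=> s; rewrite oppr_le0 !mulr_ge0 // ?invr_ge0 ltW // rpow_gt0.
- by move=> s rs; rewrite q_le0 ?mulr0 // t_le0.
move=> s s0.
have -> : - p * (p^-1 * q eps (t s)) - s * - (q' eps (t s) * A s / M s * M' s) =
    - q eps (t s) + q' eps (t s) * M' s * (A s * (s / M s)).
  by field; rewrite !gt_eqF.
have qt := q_ge (t s).
have [sr1|sr1] := leP s r1.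
  rewrite (le_trans sr1 (ltW r12)) !mulr1 /M' (@q'_le0 (s - r1)) ?subr_le0 // mulr0 mul0r addr0.
  have : A s = rpow p (r1 + eps) by rewrite /A /M q_le0 ?addr0 // subr_le0.
  by move: qt; rewrite /t; lra.
rewrite mulr0 subr0; have [r2s|sr2] := leP r2 s.
  rewrite q_le0 ?q'_le0 ?t_le0 // !mul0r oppr0 addr0 mulr_ge0 // addr_ge0 ?ltW //.
  exact: rpow_gt0.
rewrite (ltW sr2) mulr1.
(* Here [q'], [M'] and [s / M s] all lie in the unit interval. *)
have h : q' eps (t s) * M' s * (A s * (s / M s)) <= A s.
  rewrite -[leRHS]mul1r; apply: ler_pM.
  - exact: mulr_ge0 (q'_ge0 _) (q'_ge0 _).
  - by rewrite mulr_ge0 ?divr_ge0 // ltW // rpow_gt0.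
  - by rewrite -[leRHS]mul1r; apply: ler_pM; rewrite ?q'_ge0 ?q'_le1.
  - apply: ler_piMr; first exact/ltW/rpow_gt0.
    by rewrite ler_pdivrMr ?mul1r.
by move: qt h; rewrite /t; lra.
Qed.

End approx.
End cutoff.

(** * Monotonicity of the energy ratio from a conserved stress tensor *)

(** As in [is_derive_comp_diff], [F] is restricted to a line, since only one of
    its directional derivatives is assumed to exist. *)
Lemma is_derive_comp_real (R : realType) (U : normedModType R) (phi : R -> R) (F : U -> R)
    p v (a b : R) :
  is_derive (F p) 1 phi a -> is_derive p v F b -> is_derive p v (phi \o F) (a * b).
Proof.
move=> dphi [dF EF]; pose G (t : R) := F (t *: v + p).
have G0 : G 0 = F p by rewrite /G scale0r add0r.
have dG : is_derive (0 : R) 1 G b.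
  have E0 : 0 *: v + p = p by rewrite scale0r add0r.
  have d0 : derivable F (0 *: v + p) v by rewrite E0.
  by apply: (is_derive_eq (is_derive_line d0)); rewrite E0.
rewrite -G0 in dphi; have [d E] := is_derive1_comp dphi dG.
split; first by apply/derivable1P.
rewrite -E /derive; suff -> : (fun h : R => h^-1 *: ((phi \o F) (h *: v + p) - (phi \o F) p)) =
  (fun h : R => h^-1 *: ((phi \o G) (h *: (1 : R) + 0) - (phi \o G) 0)) by [].
by apply/funext => h /=; rewrite [h *: 1]mulr1 addr0 G0.
Qed.

Section stress_monotonicity.
Variables (R : realType) (m : nat) (S : 'I_m -> 'I_m -> 'rV[R]_m -> R).
Variable x0 : 'rV[R]_m.
Hypothesis m2 : (2 < m)%N.
Hypothesis S_C1 : forall i j, C1_on setT (S i j).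
Hypothesis S_psd : forall x (a : 'I_m -> R), 0 <= \sum_i \sum_j a i * a j * S i j x.
Local Notation dd i := (delta_mx ord0 i : 'rV[R]_m).
Hypothesis S_cons : forall j x,
  \sum_i 'D_(dd i) (S i j) x = 2^-1 * \sum_i 'D_(dd j) (S i i) x.

Let e x := \sum_i S i i x.
Let y j (x : 'rV[R]_m) := x ord0 j - x0 ord0 j.
Let sq x := \sum_j y j x ^+ 2.

(** The trace is the sum of the values of [S] on the coordinate vectors. *)
Lemma energy_ge0 x : 0 <= e x.
Proof.
apply: sumr_ge0 => i _; have := S_psd x (fun j => (j == i)%:R).
rewrite (bigD1 i) //= [X in _ + X]big1 ?addr0; last first.
  by move=> j ji; rewrite big1 // => l _; rewrite (negbTE ji) !mul0r.
rewrite (bigD1 i) //= big1 ?addr0 ?eqxx ?mul1r //.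
by move=> j ji; rewrite (negbTE ji) mulr0 mul0r.
Qed.

Let e_C1 : C1_on setT e.
Proof. apply: C1_on_sum => //; exact: openT. Qed.

Let ce : continuous e. Proof. by move=> x; exact: (@e_C1 x I).1. Qed.

(* The stress-energy tensor. *)
Let T i j x := S i j x - (i == j)%:R * 2^-1 * e x.

Let T_C1 i j : C1_on setT (T i j).
Proof.
have oT := @openT 'rV[R]_m.
apply: (C1_onD oT (@S_C1 i j)); apply: (C1_onN oT).
by apply: (C1_onM oT _ e_C1); exact: C1_on_cst.
Qed.

Let dT i j x v : is_derive x v (T i j) ('D_v (S i j) x - (i == j)%:R * 2^-1 * 'D_v e x).
Proof.
have [_ /(_ v)[d1 _]] := S_C1 i j (x := x) I.
have [_ /(_ v)[d2 _]] := e_C1 (x := x) I.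
apply: is_deriveB; first exact: derivableP.
have d := is_deriveM (is_derive_cst ((i == j)%:R * 2^-1 : R) x v) (derivableP d2).
by apply: (is_derive_eq d); rewrite /GRing.scale /= mulr0 addr0.
Qed.

(** The conservation law [S_cons] makes the divergence of [S] the gradient of
    [1/2 e], which is the divergence of the subtracted diagonal part. *)
Let div_T j x : \sum_i 'D_(dd i) (T i j) x = 0.
Proof.
under eq_bigr do rewrite (derive_val (is_derive := dT _ _ _ _)).
rewrite sumrB S_cons.
have -> : \sum_i (i == j)%:R * 2^-1 * 'D_(dd i) e x = 2^-1 * 'D_(dd j) e x.
  rewrite (bigD1 j) //= eqxx mul1r big1 ?addr0 // => i ij.
  by rewrite (negbTE ij) !mul0r.
rewrite -mulrBr; have -> : 'D_(dd j) e x = \sum_i 'D_(dd j) (S i i) x.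
  have d i : is_derive x (dd j) (S i i) ('D_(dd j) (S i i) x).
    by apply: derivableP; have [_ /(_ (dd j))[]] := S_C1 i i (x := x) I.
  have := derive_val (is_derive := is_derive_sum d).
  by move=> <-; congr derive; apply/funext => z; rewrite fct_sumE.
by rewrite subrr mulr0.
Qed.

Let dy j x i : is_derive x (dd i) (y j) (i == j)%:R.
Proof.
have did : derivable (id : 'rV[R]_m -> 'rV[R]_m) x (dd i) by exact: derivable_id.
have dc : derivable (fun z : 'rV[R]_m => z ord0 j) x (dd i) by exact: (derivable_mxP _ _ _).1 did _ _.
have E : 'D_(dd i) (fun z : 'rV[R]_m => z ord0 j) x = (i == j)%:R.
  have := congr1 (fun M : 'rV[R]_m => M ord0 j) (derive_mx did).
  by rewrite derive_id !mxE eqxx /= eq_sym => <-.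
apply: (is_derive_eq (is_deriveB (derivableP dc) (is_derive_cst (x0 ord0 j) x (dd i)))).
by rewrite subr0.
Qed.

Let cy j : continuous (y j).
Proof.
move=> x; have := @continuous_atD R _ (fun z : 'rV[R]_m => z ord0 j) (fun=> - x0 ord0 j) x.
by apply; [exact: continuous_coord|exact: continuous_at_cst].
Qed.

Let dsq x i : is_derive x (dd i) sq (2 * y i x).
Proof.
have d j : is_derive x (dd i) (fun z => y j z ^+ 2) (2 * y j x * (i == j)%:R).
  apply: (is_derive_eq (is_deriveM (dy j x i) (dy j x i))).
  by rewrite /GRing.scale /= -mulrA mulr_natl mulr2n.
rewrite (_ : sq = \sum_j (fun z => y j z ^+ 2)); last first.
  by apply/funext => z; rewrite fct_sumE.
apply: (is_derive_eq (is_derive_sum d)).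
rewrite (bigD1 i) //= eqxx mulr1 big1 ?addr0 // => j ji.
by rewrite eq_sym (negbTE ji) mulr0.
Qed.

Let csq : continuous sq.
Proof.
move=> x; apply: continuous_at_sum => j.
by apply: continuous_atM; exact: cy.
Qed.

Lemma ball_measurable r : measurable [set x | sq x <= r].
Proof.
rewrite -[X in measurable X]setTI.
have := continuous_measurable_row csq measurableT (measurable_itv `]-oo, r]).
by congr measurable; apply/seteqP; split => x [_ /=]; rewrite in_itv.
Qed.

Let K0 r : 0 < \sum_j `|x0 ord0 j| + Num.sqrt r + 1.
Proof. by rewrite ltr_wpDl // addr_ge0 ?sqrtr_ge0 // sumr_ge0. Qed.

Lemma ball_bounded r x : sq x <= r -> forall j, `|x ord0 j| <= \sum_j `|x0 ord0 j| + Num.sqrt r + 1.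
Proof.
move=> sr j; have yj : `|y j x| <= Num.sqrt r.
  rewrite -sqrtr_sqr ler_wsqrtr //; apply: le_trans sr.
  by rewrite /sq (bigD1 j) //= lerDl sumr_ge0 // => i _; rewrite sqr_ge0.
have x0j : `|x0 ord0 j| <= \sum_j `|x0 ord0 j|.
  by rewrite (bigD1 j) //= lerDl sumr_ge0.
rewrite -[x ord0 j](subrK (x0 ord0 j)) -/(y j x).
apply: le_trans (ler_normD _ _) _; lra.
Qed.

Lemma energy_integrable r : (lebesgue_row R m).-integrable [set x | sq x <= r] (EFin \o e).
Proof.
apply: (bounded_set_integrable (K0 r)) => //; first exact: ball_measurable.
exact: ball_bounded.
Qed.

Section test_field.
Variables (eta eta' : R -> R) (r : R).
Hypotheses (deta : forall s : R, is_derive s 1 eta (eta' s)) (ceta' : continuous eta')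
  (eta'_le0 : forall s, eta' s <= 0) (eta_out : forall s, r <= s -> eta s = 0).

(** The components of the stress tensor contracted with the cut-off radial
    field. *)
Let Xi i x := \sum_j T i j x * (y j x * eta (sq x)).

Let divXi i x := \sum_j (T i j x * (y j x * (eta' (sq x) * (2 * y i x)) + eta (sq x) * (i == j)%:R) +
  y j x * eta (sq x) * ('D_(dd i) (S i j) x - (i == j)%:R * 2^-1 * 'D_(dd i) e x)).

Let dXi i x : is_derive x (dd i) (Xi i) (divXi i x).
Proof.
rewrite (_ : Xi i = \sum_j (fun z => T i j z * (y j z * eta (sq z)))); last first.
  by apply/funext => z; rewrite fct_sumE.
apply: is_derive_sum => j.
have d1 := is_derive_comp_real (deta (sq x)) (dsq x i).
have d2 := is_deriveM (dy j x i) d1.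
exact: is_deriveM (dT i j x (dd i)) d2.
Qed.

Let ceta : continuous eta.
Proof. by move=> s; apply/differentiable_continuous/derivable1_diffP; have [] := deta s. Qed.

Let cetasq : continuous (fun x => eta (sq x)).
Proof. by move=> x; apply: (@continuous_comp _ _ _ sq eta); [exact: csq|exact: ceta]. Qed.

Let ceta'sq : continuous (fun x => eta' (sq x)).
Proof. by move=> x; apply: (@continuous_comp _ _ _ sq eta'); [exact: csq|exact: ceta']. Qed.

Let cT i j : continuous (T i j). Proof. by move=> x; exact: (@T_C1 i j x I).1. Qed.

Let cdivXi i : continuous (divXi i).
Proof.
move=> x; apply: continuous_at_sum => j; apply: continuous_atD.
  apply: continuous_atM; first exact: cT.
  apply: continuous_atD; apply: continuous_atM; [exact: cy| |exact: cetasq|exact: continuous_at_cst].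
  apply: continuous_atM; first exact: ceta'sq.
  by apply: continuous_atM; [exact: continuous_at_cst|exact: cy].
apply: continuous_atM; first by apply: continuous_atM; [exact: cy|exact: cetasq].
rewrite (_ : (fun _ => _) = 'D_(dd i) (T i j)).
  by have [_ /(_ (dd i))[]] := @T_C1 i j x I.
by apply/funext => z; rewrite (derive_val (is_derive := dT i j z (dd i))).
Qed.

Let DXi i : 'D_(dd i) (Xi i) = divXi i.
Proof. by apply/funext => x; exact: (derive_val (is_derive := dXi i x)). Qed.

Let K := \sum_j `|x0 ord0 j| + Num.sqrt r + 1.

Let supXi i : supported (Xi i) K.
Proof.
move=> x [j Kj]; rewrite /Xi big1 // => l _; rewrite eta_out ?mulr0 //.
rewrite leNgt; apply/negP => h; move: Kj; rewrite ltNge => /negP; apply.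
exact: ball_bounded (ltW h) j.
Qed.

(** The divergence of [T] contributes nothing, its trace gives [(1 - m / 2) e], and
    the radial term is [2 eta' (S(y, y) - 1/2 e |y|^2)], in which [eta' S(y, y)]
    is nonpositive. *)
Let divXiE x : \sum_i divXi i x <= e x * (- ((m%:R - 2) / 2) * eta (sq x) - sq x * eta' (sq x)).
Proof.
have -> : \sum_i divXi i x = eta (sq x) * (\sum_i T i i x)
    + 2 * eta' (sq x) * (\sum_i \sum_j y i x * y j x * T i j x)
    + eta (sq x) * \sum_j y j x * \sum_i 'D_(dd i) (T i j) x.
  have -> : \sum_j y j x * \sum_i 'D_(dd i) (T i j) x = \sum_i \sum_j y j x * 'D_(dd i) (T i j) x.
    by under eq_bigr do rewrite mulr_sumr; rewrite exchange_big.
  rewrite !mulr_sumr -!big_split; apply: eq_bigr => i _ /=.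
  have -> : eta (sq x) * T i i x = \sum_j (i == j)%:R * (eta (sq x) * T i j x).
    rewrite (bigD1 i) //= eqxx mul1r big1 ?addr0 // => j ji.
    by rewrite eq_sym (negbTE ji) mul0r.
  rewrite !mulr_sumr -!big_split; apply: eq_bigr => j _ /=.
  by rewrite (derive_val (is_derive := dT i j x (dd i))); ring.
have -> : \sum_j y j x * \sum_i 'D_(dd i) (T i j) x = 0.
  by rewrite big1 // => j _; rewrite div_T mulr0.
have -> : \sum_i T i i x = e x - m%:R / 2 * e x.
  rewrite sumrB; congr (_ - _); under eq_bigr do rewrite eqxx mul1r.
  by rewrite sumr_const card_ord -[LHS]mulr_natl mulrA.
have -> : \sum_i \sum_j y i x * y j x * T i j x =
    \sum_i \sum_j y i x * y j x * S i j x - 2^-1 * e x * sq x.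
  rewrite /sq mulr_sumr -sumrB; apply: eq_bigr => i _.
  have -> : 2^-1 * e x * y i x ^+ 2 = \sum_j (i == j)%:R * (2^-1 * e x * y i x * y j x).
    rewrite (bigD1 i) //= eqxx mul1r big1 ?addr0 ?expr2 ?mulrA // => j ji.
    by rewrite eq_sym (negbTE ji) mul0r.
  by rewrite -sumrB; apply: eq_bigr => j _; rewrite /T; ring.
have Q := S_psd x (y^~ x).
have := mulr_ge0_le0 Q (eta'_le0 (sq x)).
set q := \sum_i \sum_j _; move: (m%:R : R) (sq x) (e x) (eta (sq x)) (eta' (sq x)) => M s E h h'.
by move=> qh; rewrite -subr_ge0 (_ : _ - _ = - 2 * (q * h')); [rewrite mulNr oppr_ge0 pmulr_rle0 ?ltr0n|field].
Qed.

Let mu := lebesgue_row R m.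
Let B s := [set x | sq x <= s].
(** The radius enters through its square [s]. *)
Definition ball_energy s : R := fine (\int[mu]_(x in B s) (e x)%:E).

Lemma ball_energyE s : (\int[mu]_(x in B s) (e x)%:E = (ball_energy s)%:E)%E.
Proof.
rewrite fineK //; apply: integrable_fin_num; first exact: ball_measurable.
exact: energy_integrable.
Qed.

Let eB s x := e x * (sq x <= s)%R%:R.

Let eBE s : (EFin \o e) \_ (B s) = EFin \o eB s.
Proof.
apply/funext => x; rewrite patchE /eB /=; case: ifPn; rewrite ?inE ?notin_setE /B /=.
  by move=> ->; rewrite mulr1.
by move=> /negP/negbTE ->; rewrite mulr0.
Qed.

Let eB_int s : mu.-integrable setT (EFin \o eB s).
Proof.
rewrite -eBE.
exact: ((integrable_mkcond _ (ball_measurable s)).1 (energy_integrable s)).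
Qed.

Let int_eB s : (\int[mu]_x (eB s x)%:E = (ball_energy s)%:E)%E.
Proof. by rewrite -ball_energyE [RHS]integral_mkcond eBE. Qed.

Let int_ZeB c s : (\int[mu]_x (c * eB s x)%:E = (c * ball_energy s)%:E)%E.
Proof.
rewrite EFinM -int_eB -(integralZl measurableT (eB_int s) c).
by apply: eq_integral => x _; rewrite EFinM.
Qed.

Let int_divXi i : mu.-integrable setT (EFin \o divXi i).
Proof.
apply: (supported_integrable (K0 r)) => //.
by rewrite -DXi; exact: supported_derive.
Qed.

(** The divergence of the compactly supported field [Xi] has integral zero and is
    at most [e] times the combination of [eta] and [eta'] in the hypothesis,
    which in turn is dominated by a difference of multiples of indicator functions
    of balls. *)
Lemma test_field_inequality r' a b :
  (forall s, 0 <= s -> - ((m%:R - 2) / 2) * eta s - s * eta' s <=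
    a * (s <= r)%R%:R - b * (s <= r')%R%:R) ->
  b * ball_energy r' <= a * ball_energy r.
Proof.
move=> hz.
have I0 : (\int[mu]_x (\sum_i divXi i x)%:E = 0)%E.
  under eq_integral do rewrite -sumEFin.
  rewrite integral_sum //=; apply: big1 => i _; rewrite -DXi.
  apply: (integral_partial_eq0 (K0 r)) => //.
  - by move=> x; have [] := dXi i x.
  - by rewrite DXi; exact: cdivXi.
pose z x := a * eB r x - b * eB r' x.
have intz : (\int[mu]_x (z x)%:E = (a * ball_energy r - b * ball_energy r')%:E)%E.
  rewrite (integralB_EFin (f1 := fun x => a * eB r x) (f2 := fun x => b * eB r' x)) //.
  - by rewrite !int_ZeB.
  - exact: (integrableZl measurableT a (eB_int r)).
  - exact: (integrableZl measurableT b (eB_int r')).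
suff : (\int[mu]_x (\sum_i divXi i x)%:E <= \int[mu]_x (z x)%:E)%E.
  by rewrite I0 intz lee_fin subr_ge0.
apply: le_integral => //.
- rewrite (_ : (fun x => _) = (fun x => \sum_i (divXi i x)%:E)%E); last first.
    by apply/funext => x; rewrite sumEFin.
  by apply: integrable_sum => // i _; exact: int_divXi.
- exact: (integrableB measurableT (integrableZl measurableT a (eB_int r)) (integrableZl measurableT b (eB_int r'))).
move=> x _; rewrite lee_fin; apply: (le_trans (divXiE x)).
have := hz (sq x) (sumr_ge0 _ (fun j _ => sqr_ge0 _)).
move=> /(ler_wpM2l (energy_ge0 x)) /le_trans; apply.
by rewrite /z /eB -/(e x) le_eqVlt; apply/orP; left; apply/eqP; ring.
Qed.

End test_field.

Lemma rpow_sqr (rho : R) : 0 < rho ->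
  rpow ((m%:R - 2) / 2) (rho ^+ 2) = (rho ^+ (m - 2))^-1.
Proof.
move=> rho0; rewrite /rpow lnXn //.
have -> : - ((m%:R - 2) / 2) * (ln rho *+ 2) = - ((m - 2)%:R * ln rho).
  by rewrite natrB ?(ltnW m2) // -mulr_natr; field.
by rewrite expRN expRM_natl lnK.
Qed.

(** In terms of squared radii, [rho ^ (2 - m)] is the power [- p] with
    [p = (m - 2) / 2].  The cut-off inequality holds for every [eps > 0], and [eps]
    tends to zero. *)
Lemma ball_energy_monotone (rho1 rho2 : R) : 0 < rho1 -> rho1 <= rho2 ->
  (rho1 ^+ (m - 2))^-1 * ball_energy (rho1 ^+ 2) <=
  (rho2 ^+ (m - 2))^-1 * ball_energy (rho2 ^+ 2).
Proof.
move=> rho10; rewrite le_eqVlt => /predU1P[->//|rho12].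
have rho20 := lt_trans rho10 rho12.
rewrite -!rpow_sqr //; set p := (m%:R - 2) / 2.
have p0 : 0 < p by rewrite divr_gt0 // subr_gt0 ltr_nat.
set r1 := rho1 ^+ 2; set r2 := rho2 ^+ 2.
have r10 : 0 < r1 by rewrite exprn_gt0.
have r12 : r1 < r2 by rewrite ltrXn2r // ?nnegrE ltW.
have bound eps : 0 < eps ->
    rpow p (r1 + eps) * ball_energy r1 <= (rpow p r2 + eps) * ball_energy r2.
  move=> eps0; have [eta [eta' [d c le0 out hz]]] := cutoff_profile eps0 p0 r10 r12.
  exact: test_field_inequality d c le0 out _ _ _ hz.
have c : {for r1, continuous (rpow p)}.
  have [d _] := is_derive_rpow p r10.
  by apply/differentiable_continuous/derivable1_diffP.
have c1 : rpow p (r1 + eps) * ball_energy r1 @[eps --> (0 : R)^'+] --> rpow p r1 * ball_energy r1.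
  apply: cvgM; last exact: cvg_cst.
  apply: cvg_at_right_filter; rewrite -[r1](addr0 r1) in c.
  have -> : rpow p r1 = rpow p (r1 + 0) by rewrite addr0.
  apply: (@continuous_comp _ _ _ (fun eps => r1 + eps) (rpow p)); last exact: c.
  by apply: cvgD; [exact: cvg_cst|exact: cvg_id].
have c2 : (rpow p r2 + eps) * ball_energy r2 @[eps --> (0 : R)^'+] --> rpow p r2 * ball_energy r2.
  apply: cvgM; last exact: cvg_cst.
  apply: cvg_at_right_filter; rewrite -[X in _ --> X]addr0.
  by apply: cvgD; [exact: cvg_cst|exact: cvg_id].
apply: (ler_cvg_to c1 c2); near=> eps; apply: bound.
by near: eps; exact: nbhs_right_gt.
Unshelve. all: by end_near. Qed.

End stress_monotonicity.

(** * From horizontal slices to cylinders *)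

Lemma continuous_pair (T U V : topologicalType) (F : T -> U) (G : T -> V) :
  continuous F -> continuous G -> continuous (fun t => (F t, G t)).
Proof. by move=> cF cG t; apply: cvg_pair; [exact: cF|exact: cG]. Qed.

Lemma continuous_slice (U V : topologicalType) (y : V) : continuous (fun x : U => (x, y)).
Proof. by apply: continuous_pair => x; [exact: cvg_id|exact: cvg_cst]. Qed.

Section slices.
Variables (R : realType) (m k : nat).
Let M := ('rV[R]_m * 'rV[R]_k)%type.

Lemma derive_slice (phi : M -> R) (y : 'rV[R]_k) (x v : 'rV[R]_m) :
  derivable phi (x, y) (v, 0) ->
  is_derive x v (fun x => phi (x, y)) ('D_(v, 0) phi (x, y)).
Proof.
move=> d; have E : (fun h : R => h^-1 *: (phi (h *: v + x, y) - phi (x, y))) =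
    (fun h : R => h^-1 *: (phi (h *: ((v, 0) : M) + (x, y)) - phi (x, y))).
  apply/funext => h; congr (_ *: (phi _ - _)).
  by rewrite -[RHS]/(h *: v + x, h *: 0 + y) scaler0 add0r.
by split; rewrite /derivable /derive /= E.
Qed.

Lemma C1_on_slice (phi : M -> R) (y : 'rV[R]_k) :
  C1_on setT phi -> C1_on setT (fun x => phi (x, y)).
Proof.
move=> C x _; have [c d] := @C (x, y) I; split.
  by apply: (@continuous_comp _ _ _ (fun x : 'rV[R]_m => (x, y)) phi); [exact: continuous_slice|exact: c].
move=> v; have [dv cv] := d (v, 0); split; first by have [] := derive_slice dv.
rewrite (_ : 'D_v _ = fun x => 'D_(v, 0) phi (x, y)); last first.
  apply/funext => z; apply: derive_val; apply: derive_slice.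
  by have [_ /(_ (v, 0))[]] := @C (z, y) I.
by apply: (@continuous_comp _ _ _ (fun x : 'rV[R]_m => (x, y)) ('D_(v, 0) phi)); [exact: continuous_slice|exact: cv].
Qed.

(** The product is identified with [R^(m + k)], where continuous functions are
    already known to be measurable. *)
Lemma continuous_measurable_prod (phi : M -> R) : continuous phi ->
  measurable_fun setT (phi : M -> measurableTypeR R).
Proof.
move=> cphi; pose psi (z : 'rV[R]_(m + k)) := phi (lsubmx z, rsubmx z).
have norm_sub (l r : nat) (h : 'I_l -> 'I_r) (F : 'rV[R]_r -> 'rV[R]_l) :
    (forall z i, F z ord0 i = z ord0 (h i)) -> continuous F.
  move=> FE; apply: nonexpansive_continuous => a b.
  rewrite [leLHS]/Num.Def.normr/= mx_normrE bigmax_le // => -[i j] _ /=.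
  rewrite (ord1 i : i = ord0) [X in `|X|]mxE [X in `|_ + X|]mxE !FE.
  rewrite [leRHS]/Num.Def.normr/= mx_normrE.
  by apply: le_trans (le_bigmax _ _ (ord0, h j)); rewrite !mxE.
have cpsi : continuous psi.
  move=> z; apply: (@continuous_comp _ _ _ (fun z : 'rV[R]_(m + k) => (lsubmx z, rsubmx z) : M) phi); last exact: cphi.
  apply: continuous_pair.
    by apply: (norm_sub _ _ (lshift k) lsubmx) => w i; rewrite mxE.
  by apply: (norm_sub _ _ (@rshift m k) rsubmx) => w i; rewrite mxE.
have mrow : measurable_fun setT (fun p : M => row_mx p.1 p.2).
  apply: measurable_fun_rowP => i; case: (split_ordP i) => j ->.
    rewrite (_ : (fun _ => _) = (fun x : 'rV[R]_m => x ord0 j : measurableTypeR R) \o fst).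
      by apply: measurableT_comp; [exact: measurable_coord|exact: measurable_fst].
    by apply/funext => p; rewrite row_mxEl.
  rewrite (_ : (fun _ => _) = (fun x : 'rV[R]_k => x ord0 j : measurableTypeR R) \o snd).
    by apply: measurableT_comp; [exact: measurable_coord|exact: measurable_snd].
  by apply/funext => p; rewrite row_mxEr.
rewrite (_ : phi = psi \o (fun p : M => row_mx p.1 p.2)).
  apply: measurableT_comp mrow; exact: continuous_measurable_row.
by apply/funext => -[a b]; rewrite /psi /= row_mxKl row_mxKr.
Qed.

Lemma euclidean_ballE l (x0 : 'rV[R]_l) rho : 0 < rho ->
  [set x : 'rV[R]_l | euclidean_norm (x - x0) <= rho] =
  [set x : 'rV[R]_l | \sum_j (x ord0 j - x0 ord0 j) ^+ 2 <= rho ^+ 2].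
Proof.
move=> rho0; apply/funext => x /=; apply/propext; rewrite /euclidean_norm.
rewrite (eq_bigr (fun j => (x ord0 j - x0 ord0 j) ^+ 2)); last by move=> j _; rewrite !mxE.
have rhoE : rho = Num.sqrt (rho ^+ 2) by rewrite sqrtr_sqr gtr0_norm.
set s := \sum_j _; suff -> : (Num.sqrt s <= rho) = (s <= rho ^+ 2) by [].
by rewrite {1}rhoE ler_sqrt ?sqr_ge0.
Qed.

End slices.

Section cylinders.
Variables (R : realType) (m k : nat).
Let M := ('rV[R]_m * 'rV[R]_k)%type.
Variable phi : M -> R.
Hypotheses (phi_ge0 : forall p, 0 <= phi p) (cphi : continuous phi).

Lemma cylinderE x0 y0 rho delta : @cylinder R m k x0 y0 rho delta =
  [set x | euclidean_norm (x - x0) <= rho] `*` [set y | euclidean_norm (y - y0) <= delta].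
Proof. by []. Qed.

Lemma measurable_cylinder x0 y0 rho delta : 0 < rho -> 0 < delta ->
  measurable (@cylinder R m k x0 y0 rho delta).
Proof.
by move=> r0 d0; rewrite cylinderE !euclidean_ballE //; apply: measurableX; exact: ball_measurable.
Qed.

Let F x0 y0 rho delta := (EFin \o phi) \_ (@cylinder R m k x0 y0 rho delta).

Let mF x0 y0 rho delta : 0 < rho -> 0 < delta -> measurable_fun setT (F x0 y0 rho delta).
Proof.
move=> r0 d0; apply: (measurable_restrictT _ (measurable_cylinder x0 y0 r0 d0)).1.
by apply/measurable_EFinP; apply: measurable_funTS; exact: continuous_measurable_prod.
Qed.

Let F_ge0 x0 y0 rho delta p : (0 <= F x0 y0 rho delta p)%E.
Proof. by rewrite /F patchE; case: ifPn => // _; rewrite lee_fin. Qed.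

Local Notation slice_energy x0 rho y :=
  (\int[lebesgue_row R m]_(x in [set x | (euclidean_norm (x - x0) <= rho)%R]) (phi (x, y))%:E)%E.

Let F_slice x0 y0 rho delta y : fubini_G (lebesgue_row R m) (F x0 y0 rho delta) y =
  if y \in [set y | euclidean_norm (y - y0) <= delta] then slice_energy x0 rho y else 0%E.
Proof.
rewrite /fubini_G; case: ifPn => yd; last first.
  apply: integral0_eq => x _; rewrite /F patchE; case: ifPn => //.
  by rewrite inE => -[_ hy]; move: yd; rewrite notin_setE.
rewrite [RHS]integral_mkcond; apply: eq_integral => x _; rewrite /F !patchE.
suff -> : ((x, y) \in @cylinder R m k x0 y0 rho delta) =
    (x \in [set x | euclidean_norm (x - x0) <= rho]) by [].
apply/idP/idP; rewrite !inE; first by case.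
by move=> hx; split => //; move: yd; rewrite inE.
Qed.

(** Tonelli's theorem: integrals over cylinders are compared slice by slice. *)
Lemma cylinder_integral_le x0 y0 rho1 rho2 delta (c1 c2 : R) :
  0 < rho1 -> 0 < rho2 -> 0 < delta -> 0 <= c1 -> 0 <= c2 ->
  (forall y, slice_energy x0 rho1 y * c1%:E <= slice_energy x0 rho2 y * c2%:E)%E ->
  ((\int[lebesgue_row R m \x lebesgue_row R k]_(p in cylinder x0 y0 rho1 delta) (phi p)%:E) * c1%:E
   <= (\int[lebesgue_row R m \x lebesgue_row R k]_(p in cylinder x0 y0 rho2 delta) (phi p)%:E) * c2%:E)%E.
Proof.
move=> r1 r2 d0 c10 c20 H.
have tonelli rho : 0 < rho ->
    (\int[lebesgue_row R m \x lebesgue_row R k]_(p in cylinder x0 y0 rho delta) (phi p)%:E =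
     \int[lebesgue_row R k]_y fubini_G (lebesgue_row R m) (F x0 y0 rho delta) y)%E.
  move=> rho0; rewrite integral_mkcond; apply: fubini_tonelli2; last exact: F_ge0.
  exact: mF.
have mG rho : 0 < rho -> measurable_fun setT (fubini_G (lebesgue_row R m) (F x0 y0 rho delta)).
  by move=> rho0; apply: measurable_fun_fubini_tonelli_G; [exact: mF|exact: F_ge0].
have G0 rho y : (0 <= fubini_G (lebesgue_row R m) (F x0 y0 rho delta) y)%E.
  by apply: integral_ge0 => x _; exact: F_ge0.
pose G rho c y := (fubini_G (lebesgue_row R m) (F x0 y0 rho delta) y * c%:E)%E.
have scaled rho (c : R) : 0 < rho -> 0 <= c ->
    ((\int[lebesgue_row R m \x lebesgue_row R k]_(p in cylinder x0 y0 rho delta) (phi p)%:E) * c%:E =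
     \int[lebesgue_row R k]_y G rho c y)%E.
  move=> rho0 c0; rewrite (tonelli _ rho0); apply: esym.
  apply: (@ge0_integralZr _ _ _ _ _ measurableT _ (mG _ rho0)); last by rewrite lee_fin.
  by move=> y _; exact: G0.
have mGc rho (c : R) : 0 < rho -> measurable_fun setT (G rho c).
  by move=> rho0; apply: emeasurable_funM; [exact: mG|exact: measurable_cst].
have Gc0 rho (c : R) y : 0 <= c -> (0 <= G rho c y)%E.
  by move=> c0; rewrite mule_ge0 // lee_fin.
rewrite (scaled _ _ r1 c10) (scaled _ _ r2 c20); apply: ge0_le_integral.
- exact: measurableT.
- by move=> y _; exact: Gc0.
- exact: mGc.
- exact: mGc.
- by move=> y _; rewrite /G !F_slice; case: ifP => // _; rewrite !mul0e.
Qed.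

End cylinders.

Theorem theorem5p2 (R : realType) (m k n : nat) (N : manifold R n)
    (F : foliation N) (g : metric N) (f : 'rV[R]_m * 'rV[R]_k -> N)
    (hm : (2 < m)%N) (hk : (1 <= k)%N)
    (hF : riemannian_foliation F g)
    (hf : smooth_map f)
    (hharm : horizontally_harmonic F g f)
    (x0 : 'rV[R]_m) (y0 : 'rV[R]_k) (delta rho1 rho2 : R)
    (hdelta : 0 < delta) (hrho1 : 0 < rho1) (hrho12 : rho1 <= rho2) :
  ((\int[lebesgue_row R m \x lebesgue_row R k]_(p in cylinder x0 y0 rho1 delta)
      (normsq_dfHH F g f p)%:E) * ((rho1 ^+ (m - 2))^-1)%:E
   <=
   (\int[lebesgue_row R m \x lebesgue_row R k]_(p in cylinder x0 y0 rho2 delta)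
      (normsq_dfHH F g f p)%:E) * ((rho2 ^+ (m - 2))^-1)%:E)%E.
Proof.
have rho20 : 0 < rho2 by exact: lt_le_trans hrho1 hrho12.
pose S y i j x := pullback_trans F g f i j (x, y).
have SC1 y i j : C1_on setT (S y i j) by apply: C1_on_slice; exact: pullback_trans_C1.
have Spsd y x (a : 'I_m -> R) : 0 <= \sum_i \sum_j a i * a j * S y i j x.
  exact: pullback_trans_psd.
have dS y i j l x : 'D_(delta_mx ord0 l) (S y i j) x =
    'D_(frameH R k l) (pullback_trans F g f i j) (x, y).
  apply: derive_val; apply: derive_slice.
  by have [_ /(_ (frameH R k l))[]] := pullback_trans_C1 F g hf i j (x := (x, y)) I.
have Scons y j x : \sum_i 'D_(delta_mx ord0 i : 'rV[R]_m) (S y i j) x =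
    2^-1 * \sum_i 'D_(delta_mx ord0 j : 'rV[R]_m) (S y i i) x.
  apply: (etrans (eq_bigr _ (fun i _ => dS y i j i x))).
  apply: (etrans (pullback_trans_conservation hF hf hharm j (x, y))).
  apply: (congr1 (fun z => 2^-1 * z)); apply: eq_bigr => i _.
  exact: (esym (dS y i i j x)).
apply: cylinder_integral_le => //.
- by move=> [x y]; exact: (energy_ge0 (Spsd y) x).
- have : C1_on setT (fun p => \sum_i pullback_trans F g f i i p).
    by apply: C1_on_sum => [|i _]; [exact: openT|exact: pullback_trans_C1].
  by move=> C p; have [] := C p I.
- by rewrite invr_ge0 exprn_ge0 // ltW.
- by rewrite invr_ge0 exprn_ge0 // ltW.
move=> y; rewrite !euclidean_ballE //.
have E rho : (\int[lebesgue_row R m]_(x in [set x : 'rV[R]_m |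
      (\sum_j (x ord0 j - x0 ord0 j) ^+ 2 <= rho ^+ 2)%R]) (normsq_dfHH F g f (x, y))%:E =
    (ball_energy (S y) x0 (rho ^+ 2))%:E)%E.
  exact: (ball_energyE x0 (SC1 y) (rho ^+ 2)).
rewrite !E -!EFinM lee_fin !(mulrC (ball_energy _ _ _)).
exact: (ball_energy_monotone x0 hm (SC1 y) (Spsd y) (Scons y) hrho1 hrho12).
Qed.
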